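(* Let $(M,\xi)$ be a contact $3$-manifold, let $N$ be a compact $1$-manifold, and let $\upsilon : N \to M$ be a continuous map. Then $\upsilon$ can be approximated by Legendrian curves in the Whitney $C^0$-topology: for every open neighborhood $\mathcal{U}$ of $\upsilon$ in $C^0(N,M)$, equipped with the Whitney $C^0$-topology, there exists a Legendrian curve $\eta : N \to M$ with $\eta \in \mathcal{U}$.
   Context: Manifolds are smooth. A contact structure on a $3$-manifold $M$ is a maximally non-integrable smooth rank $2$ subbundle $\xi$ of the tangent bundle $TM$; that is, whenever $\alpha$ is a (local) $1$-form with kernel $\xi$, one has $\alpha \wedge \mathrm{d}\alpha \neq 0$ everywhere on the domain of $\alpha$. A contact $3$-manifold is a pair $(M,\xi)$ with $M$ a $3$-manifold and $\xi$ a contact structure on $M$. A compact $1$-manifold $N$ means a compact interval or the circle $S^1$. A Legendrian curve is a smooth map $\eta : N \to M$ such that $\eta^*\alpha = 0$ for (local) $1$-forms $\alpha$ defining $\xi$, i.e. $\dot\eta(t) \in \xi_{\eta(t)}$ for all $t \in N$; it is not required to be an immersion. $C^0(N,M)$ is the set of continuous maps $N \to M$. Since $N$ is compact, the Whitney $C^0$-topology on $C^0(N,M)$ coincides with the topology of uniform convergence with respect to the distance $d_g$ induced by any Riemannian metric $g$ on $M$. *)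

(* Defs.v *)
From HB Require Import structures.
From mathcomp Require Import all_boot all_order all_algebra.
From mathcomp Require Import all_classical all_reals all_analysis.

Set Implicit Arguments.
Unset Strict Implicit.
Unset Printing Implicit Defensive.

Import Order.TTheory GRing.Theory Num.Theory.
Import numFieldNormedType.Exports.

Local Open Scope classical_set_scope.
Local Open Scope ring_scope.

(** * Smooth maps between open subsets of normed spaces *)

Section smooth_maps.
Context {R : realType} {V W : normedModType R}.

(* In finite dimension, on an open set [A] this is the usual class C^k: all
   iterated directional derivatives of order at most [k] exist and are
   continuous on [A]. *)
Fixpoint Ck_on (k : nat) (A : set V) (f : V -> W) : Prop :=
  match k with
  | 0 => forall x, A x -> {for x, continuous f}
  | k'.+1 => (forall x, A x -> differentiable f x) /\
             (forall v, Ck_on k' A (fun x => 'D_v f x))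
  end.

Definition smooth_on (A : set V) (f : V -> W) := forall k, Ck_on k A f.

End smooth_maps.

(** * Smooth 3-manifolds (without boundary) *)

(* [chart_map] and [chart_inv] are total functions; only their restrictions to
   [chart_dom] and to its image are meaningful, and these are mutually inverse
   homeomorphisms between open sets. *)
Record chart (R : realType) (M : topologicalType) := Chart {
  chart_dom : set M ;
  chart_map :> M -> 'rV[R]_3 ;
  chart_inv : 'rV[R]_3 -> M ;
  chart_dom_open : open chart_dom ;
  chart_img_open : open (chart_map @` chart_dom) ;
  chartK : forall p, chart_dom p -> chart_inv (chart_map p) = p ;
  chart_continuous : forall p, chart_dom p -> {for p, continuous chart_map} ;
  chart_inv_continuous : forall x,
    (chart_map @` chart_dom) x -> {for x, continuous chart_inv} }.

Definition transition (R : realType) (M : topologicalType) (c d : chart R M) :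
    'rV[R]_3 -> 'rV[R]_3 :=
  fun x => d (chart_inv c x).

(* The atlas need not be maximal. *)
Record manifold3 (R : realType) := Manifold3 {
  mfd_space :> topologicalType ;
  mfd_hausdorff : hausdorff_space mfd_space ;
  mfd_second_countable : @second_countable mfd_space ;
  mfd_index : Type ;
  atlas : mfd_index -> chart R mfd_space ;
  atlas_cover : forall p, exists i, chart_dom (atlas i) p ;
  atlas_smooth : forall i j,
    smooth_on (atlas i @` (chart_dom (atlas i) `&` chart_dom (atlas j)))
              (transition (atlas i) (atlas j)) }.

Section contact_structures.
Context {R : realType} (M : manifold3 R).

(* A tangent vector at [p] is the family of its coordinate representations in
   the charts around [p], related by the differentials of the transition maps;
   the entries of charts not containing [p] carry no information and are 0. *)
Definition tangent_space (p : M) : set (mfd_index M -> 'rV[R]_3) :=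
  [set v | (forall i, ~ chart_dom (atlas i) p -> v i = 0) /\
           (forall i j, chart_dom (atlas i) p -> chart_dom (atlas j) p ->
              v j = 'd (transition (atlas i) (atlas j)) (atlas i p) (v i))].

Definition tangent_distribution := M -> set (mfd_index M -> 'rV[R]_3).

(* The rows of [F] are the coordinates of a local frame of [xi]. *)
Definition smooth_rank2_subbundle (xi : tangent_distribution) : Prop :=
  (forall p, xi p `<=` tangent_space p) /\
  (forall p i, chart_dom (atlas i) p ->
     exists (A : set 'rV[R]_3) (F : 'rV[R]_3 -> 'M[R]_(2, 3)),
       [/\ open_nbhs (atlas i p) A, smooth_on A F &
           forall q, chart_dom (atlas i) q -> A (atlas i q) ->
             row_free (F (atlas i q)) /\
             (forall v, tangent_space q v ->
                xi q v <-> (v i <= F (atlas i q))%MS)]).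

(* A 1-form on an open subset of R^3 is given by its coefficients
   [alpha : 'rV_3 -> 'cV_3]. *)
Definition form_eval (alpha : 'rV[R]_3 -> 'cV[R]_3) (v x : 'rV[R]_3) : R :=
  (v *m alpha x) 0 0.

Definition dform (alpha : 'rV[R]_3 -> 'cV[R]_3) (v w x : 'rV[R]_3) : R :=
  'D_v (form_eval alpha w) x - 'D_w (form_eval alpha v) x.

Definition wedge_dform (alpha : 'rV[R]_3 -> 'cV[R]_3) (u v w x : 'rV[R]_3) : R :=
  form_eval alpha u x * dform alpha v w x
  + form_eval alpha v x * dform alpha w u x
  + form_eval alpha w x * dform alpha u v x.

(* [alpha] is the expression in the chart [i] of a smooth 1-form on the open
   set of points of the chart whose coordinates lie in [A], with kernel [xi]. *)
Definition local_defining_form (xi : tangent_distribution) (i : mfd_index M)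
    (A : set 'rV[R]_3) (alpha : 'rV[R]_3 -> 'cV[R]_3) : Prop :=
  [/\ open A, A `<=` atlas i @` chart_dom (atlas i), smooth_on A alpha &
      forall q, chart_dom (atlas i) q -> A (atlas i q) ->
        forall v, tangent_space q v ->
          xi q v <-> form_eval alpha (v i) (atlas i q) = 0].

(* Non-vanishing of alpha /\ d alpha is a pointwise condition, depending only
   on the germ of alpha and invariant under changes of coordinates, so it
   suffices to consider 1-forms defined inside a chart. *)
Definition contact_structure (xi : tangent_distribution) : Prop :=
  smooth_rank2_subbundle xi /\
  (forall i A alpha, local_defining_form xi i A alpha ->
     forall x, A x -> exists u v w, wedge_dform alpha u v w x != 0).

End contact_structures.

Record contact_manifold3 (R : realType) := ContactManifold3 {
  contact_mfd :> manifold3 R ;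
  contact_dist : tangent_distribution contact_mfd ;
  contact_distP : contact_structure contact_dist }.

(** * Compact 1-manifolds *)

Inductive compact_1manifold (R : realType) :=
  | CompactInterval (a b : R) of a < b
  | Circle.

Definition space_of_1manifold (R : realType) (N : compact_1manifold R) :
    topologicalType :=
  match N with
  | CompactInterval a b _ => set_type [set t : R | a <= t <= b]
  | Circle => set_type [set z : R * R | z.1 ^+ 2 + z.2 ^+ 2 = 1]
  end.

Coercion space_of_1manifold : compact_1manifold >-> topologicalType.

(* [param_at N t x]: the point [x] has parameter [t], for the tautological
   parametrization of an interval and t |-> (cos t, sin t) of the circle. *)
Definition param_at (R : realType) (N : compact_1manifold R) (t : R) : N -> Prop :=
  match N return space_of_1manifold N -> Prop with
  | CompactInterval a b _ => fun x => \val x = t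
  | Circle => fun x => \val x = (cos t, sin t)
  end.

(** * The Whitney C^0-topology *)

Definition whitneyC0 (N M : topologicalType) : Type := continuousType N M.

Section whitney_topology.
Context (N M : topologicalType).

Definition whitney_base (A : set (N * M)) : set (whitneyC0 N M) :=
  [set f : continuousType N M | forall x, A (x, f x)].

Lemma whitney_base_cover :
  \bigcup_(A in (open : set_system (N * M)%type)) whitney_base A = setT.
Proof.
rewrite -subTset => f _; exists setT => //; exact: openT.
Qed.

Lemma whitney_base_join (A B : set (N * M)) f :
  open A -> open B -> whitney_base A f -> whitney_base B f ->
  exists C, [/\ open C, whitney_base C f &
                whitney_base C `<=` whitney_base A `&` whitney_base B].
Proof.
move=> oA oB Af Bf; exists (A `&` B); split; first exact: openI.
- by move=> x; split; [exact: Af | exact: Bf].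
- by move=> g ABg; split => x; have [] := ABg x.
Qed.

HB.instance Definition _ := Choice.copy (whitneyC0 N M) (continuousType N M).
HB.instance Definition _ := isBaseTopological.Build (whitneyC0 N M)
  whitney_base_cover whitney_base_join.

End whitney_topology.

(** * Legendrian curves *)

Section legendrian_curves.
Context {R : realType} {N : compact_1manifold R}.

(* Near the point of parameter [t], the curve [eta] stays in the chart [i] and
   [f] is its coordinate expression. At an endpoint of an interval, [f] extends
   this expression to a neighborhood of [t] in the real line. *)
Definition smooth_local_expression (M : manifold3 R) (eta : N -> M)
    (i : mfd_index M) (t : R) (f : R -> 'rV[R]_3) : Prop :=
  exists A : set R, [/\ open_nbhs t A, smooth_on A f &
    forall s y, A s -> param_at s y ->
      chart_dom (atlas i) (eta y) /\ atlas i (eta y) = f s].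

Definition smooth_curve (M : manifold3 R) (eta : N -> M) : Prop :=
  forall (x : N) (t : R) (i : mfd_index M),
    param_at t x -> chart_dom (atlas i) (eta x) ->
    exists f, smooth_local_expression eta i t f.

Definition is_velocity (M : manifold3 R) (eta : N -> M) (x : N) (t : R)
    (v : mfd_index M -> 'rV[R]_3) : Prop :=
  tangent_space (eta x) v /\
  (forall i, chart_dom (atlas i) (eta x) ->
     exists f, smooth_local_expression eta i t f /\ v i = derive1 f t).

Definition legendrian (M : contact_manifold3 R) (eta : N -> M) : Prop :=
  smooth_curve eta /\
  (forall (x : N) (t : R), param_at t x ->
     exists v, is_velocity eta x t v /\ contact_dist (eta x) v).

End legendrian_curves.

(* Main.v *)
Require Import Defs.
From HB Require Import structures.
From mathcomp Require Import all_boot all_order all_algebra.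
From mathcomp Require Import all_classical all_reals all_analysis.
From mathcomp Require Import ring lra.

Set Implicit Arguments.
Unset Strict Implicit.
Unset Printing Implicit Defensive.

Import Order.TTheory GRing.Theory Num.Theory.
Import numFieldNormedType.Exports.

Local Open Scope classical_set_scope.
Local Open Scope ring_scope.

(** Legendrian curves need not be immersions, so two Legendrian arcs that are
    constant near a common endpoint can be concatenated without spoiling
    smoothness. Hence it suffices to join nearby points: every point p has,
    inside any given neighbourhood V, a neighbourhood W any two points of which
    are joined within V by a Legendrian arc that is constant near both ends
    ([short_legendrian_arcs]). A continuous path is then cut into short pieces
    whose endpoints are joined by such arcs ([legendrian_approx]); the circle is
    treated as a path over one period whose approximation, being constant near
    both ends, extends periodically ([legendrian_at_periodic]).

    Short arcs are found in a chart. Let alpha be a 1-form defining the contact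
    structure and e0, e1, e2 a basis at p with alpha(e0) = alpha(e1) = 0 and
    alpha(e2) <> 0 at p. In the affine coordinates (x, y, z) of this basis,
    being horizontal means z' = f x' + g y' with f = - alpha(e0) / alpha(e2) and
    g = - alpha(e1) / alpha(e2), so every short curve in the (x, y)-plane has a
    horizontal lift from a given small initial height, the solution of a scalar
    differential equation ([picard]). Both f and g vanish at p, and
    g_x - f_y is - dalpha(e0, e1) / alpha(e2), which the contact condition makes
    nonzero ([contact_frame]). Lifting a small plane loop therefore changes the
    height by (g_x - f_y) times the enclosed area, up to higher order
    ([loop_displacement]).

    To join two points, take the straight segment between their projections and
    superpose a loop with amplitudes s and r in the two directions. For fixed
    small r the final height of the lift depends continuously on s and on the two
    points. When both points are p, it has opposite strict signs for s = r and
    s = - r. Hence, for points close enough to p, the final heights for s = r and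
    s = - r lie on either side of the height of the second point, and the
    intermediate value theorem provides an s for which the lift ends exactly there
    ([lift_connects]). Reparametrizing by a smooth step function makes the arc
    constant near its ends. *)

(** * Calculus of functions of class C^k *)

Section smooth_calculus.
Context {R : realType}.
Implicit Types U V W : normedModType R.

Lemma near_eq_differentiable V W (f g : V -> W) (x : V) :
  (\near x, f x = g x) -> differentiable f x -> differentiable g x.
Proof.
move=> fg df.
have cdf : continuous ('d f x) by exact: diff_continuous.
have gE : g \o shift x = cst (g x) + 'd f x +o_ 0 id.
  have /eqaddoP fE := diff_locally df.
  apply/eqaddoP => e e0; have := fE e e0.
  have := fg; rewrite (near_shift 0 x) => fg0.
  apply: filterS2 fg0 => y /=; rewrite subr0 => fgy.
  by rewrite -(nbhs_singleton fg) /= !fctE /= -fgy.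
apply/diff_locallyP; rewrite (diff_unique cdf gE); split => //.
Qed.

(** Bilinearity gives the Leibniz rule for a scalar function times a
    vector-valued one. *)
Lemma scale_is_bilinear W : bilinear_for
    (GRing.Scale.Law.clone _ _ *:%R _) (GRing.Scale.Law.clone _ _ *:%R _)
    (@GRing.scale R W : R -> W -> W).
Proof.
split=> [u'|u] a x y /=; first by rewrite scalerDl scalerA.
by rewrite scalerDr !scalerA mulrC.
Qed.
HB.instance Definition _ W := bilinear_isBilinear.Build R R W W _ _
  (@GRing.scale R W : R -> W -> W) (scale_is_bilinear W).

Lemma is_diff_scale V W (a da : V -> R) (f df : V -> W) x :
  is_diff x a da -> is_diff x f df ->
  is_diff x (fun y => a y *: f y) (fun v => a x *: df v + da v *: f x).
Proof.
move=> dax dfx.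
pose s : {bilinear R -> W -> W} := (@GRing.scale R W : R -> W -> W).
have sc : continuous (fun p : R * W => s p.1 p.2) by move=> p; exact: scale_continuous.
have ds : is_diff (a x, f x) (fun p : R * W => s p.1 p.2)
   (fun q => s (a x) q.2 + s q.1 (f x)).
  apply: DiffDef; first exact: differentiable_bilin.
  by rewrite diff_bilin.
exact: (@is_diff_comp _ _ _ _ (fun y => (a y, f y)) _ (fun p : R * W => s p.1 p.2)).
Qed.

Lemma Ck_onS V W k (A B : set V) (f : V -> W) :
  A `<=` B -> Ck_on k B f -> Ck_on k A f.
Proof.
elim: k f => [|k IH] f AB /=; first by move=> fB x /AB/fB.
by move=> [df Df]; split=> [x /AB/df//|v]; exact: IH.
Qed.

Lemma Ck_onW V W k (A : set V) (f : V -> W) : Ck_on k.+1 A f -> Ck_on k A f.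
Proof.
elim: k f => [f [df _] x /df|k IH f [df Df]]; first exact: differentiable_continuous.
by split=> // v; exact: IH.
Qed.

Lemma Ck_on_ext V W k (A : set V) (f g : V -> W) : open A ->
  (forall x, A x -> f x = g x) -> Ck_on k A f -> Ck_on k A g.
Proof.
move=> oA; have nA x : A x -> \forall y \near x, A y by move=> Ax; exact: open_nbhs_nbhs.
elim: k f g => [|k IH] f g fg.
  move=> fc x Ax; rewrite /prop_for /continuous_at -(fg _ Ax).
  apply: cvg_trans (fc x Ax); apply: near_eq_cvg.
  by apply: filterS (nA _ Ax) => y /fg.
move=> [df Df]; split=> [x Ax|v].
  apply: near_eq_differentiable (df x Ax).
  by apply: filterS (nA _ Ax) => y /fg.
apply: IH (Df v) => x Ax; apply: near_eq_derive.
by apply: filterS (nA _ Ax) => y /fg.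
Qed.

Lemma Ck_on_cst V W k (A : set V) (w : W) : Ck_on k A (fun=> w).
Proof.
elim: k w => [w x _|k IH w]; first exact: cvg_cst.
split=> [x _|v]; first exact: differentiable_cst.
have -> : (fun x => 'D_v (fun=> w) x) = (fun=> 0) :> (V -> W).
  by apply/funext => x; exact: derive_cst.
exact: IH.
Qed.

Lemma Ck_onD V W k (A : set V) (f g : V -> W) : open A ->
  Ck_on k A f -> Ck_on k A g -> Ck_on k A (fun x => f x + g x).
Proof.
move=> oA; elim: k f g => [f g fA gA x Ax|k IH f g [df Df] [dg Dg]].
  by apply: continuousD; [exact: fA|exact: gA].
split=> [x Ax|v]; first by apply: differentiableD; [exact: df|exact: dg].
apply: (Ck_on_ext oA) (IH _ _ (Df v) (Dg v)) => x Ax.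
by rewrite -deriveD //; apply: diff_derivable; [exact: df|exact: dg].
Qed.

Lemma Ck_onZ V W k (A : set V) (a : V -> R) (f : V -> W) : open A ->
  Ck_on k A a -> Ck_on k A f -> Ck_on k A (fun x => a x *: f x).
Proof.
move=> oA; elim: k a f => [a f aA fA x Ax|k IH a f aC fC].
  by apply: cvgZ; [exact: aA|exact: fA].
have [[da Da] [df Df]] := (aC, fC).
have dx x : A x -> is_diff x (fun y => a y *: f y)
    (fun v => a x *: 'd f x v + 'd a x v *: f x).
  by move=> Ax; apply: is_diff_scale; apply: differentiableP; [exact: da|exact: df].
split=> [x Ax|v]; first by have [] := dx x Ax.
apply: (Ck_on_ext oA) (Ck_onD oA (IH _ _ (Ck_onW aC) (Df v)) (IH _ _ (Da v) (Ck_onW fC))).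
move=> x Ax; have [dd E] := dx x Ax.
by rewrite (deriveE _ dd) E !deriveE //; [exact: da|exact: df].
Qed.

Lemma Ck_onM V k (A : set V) (a b : V -> R) : open A ->
  Ck_on k A a -> Ck_on k A b -> Ck_on k A (fun x => a x * b x).
Proof. exact: Ck_onZ. Qed.

Lemma Ck_onN V W k (A : set V) (f : V -> W) : open A ->
  Ck_on k A f -> Ck_on k A (fun x => - f x).
Proof.
move=> oA fC; have := Ck_onZ oA (Ck_on_cst k A (-1 : R)) fC.
by apply: Ck_on_ext => // x _; rewrite scaleN1r.
Qed.

Lemma Ck_onB V W k (A : set V) (f g : V -> W) : open A ->
  Ck_on k A f -> Ck_on k A g -> Ck_on k A (fun x => f x - g x).
Proof. by move=> oA fC gC; apply: Ck_onD => //; exact: Ck_onN. Qed.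

Lemma Ck_on_sum V W k (A : set V) n (f : 'I_n -> V -> W) : open A ->
  (forall i, Ck_on k A (f i)) -> Ck_on k A (fun x => \sum_i f i x).
Proof.
move=> oA; elim: n f => [|n IH] f fC.
  by apply: (Ck_on_ext oA) (Ck_on_cst k A 0) => x _; rewrite big_ord0.
have fC' i := fC (widen_ord (leqnSn n) i).
apply: (Ck_on_ext oA) (Ck_onD oA (IH _ fC') (fC ord_max)).
by move=> x _; rewrite big_ord_recr.
Qed.

Lemma Ck_on_inv V k (A : set V) (a : V -> R) : open A ->
  (forall x, A x -> a x != 0) -> Ck_on k A a -> Ck_on k A (fun x => (a x)^-1).
Proof.
move=> oA a0; elim: k a a0 => [a a0 aA x Ax|k IH a a0 aC].
  by apply: continuousV; [exact: a0|exact: aA].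
have [da Da] := aC; split=> [x Ax|v].
  by apply: differentiableV; [exact: da|exact: a0].
have iC := IH _ a0 (Ck_onW aC).
apply: (Ck_on_ext oA) (Ck_onN oA (Ck_onM oA (Ck_onM oA iC iC) (Da v))).
move=> x Ax; rewrite deriveV; [|exact: a0|exact/diff_derivable/da].
by rewrite /GRing.scale /= expr2 invfM mulNr.
Qed.

Lemma differentiable_lincomb V U n (b : 'I_n -> U) (c : 'I_n -> V -> R) x :
  (forall j, differentiable (c j) x) ->
  differentiable (fun y => \sum_j c j y *: b j) x.
Proof.
move=> dc.
rewrite (_ : (fun _ => _) = \sum_j (fun y => c j y *: b j)); last first.
  by apply/funext => y; rewrite fct_sumE.
by apply: differentiable_sum => j; exact: differentiableZl.
Qed.

Lemma derive_lincomb V U n (b : 'I_n -> U) (c : 'I_n -> V -> R) x v :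
  (forall j, differentiable (c j) x) ->
  'D_v (fun y => \sum_j c j y *: b j) x = \sum_j 'D_v (c j) x *: b j.
Proof.
move=> dc.
rewrite (_ : (fun _ => _) = \sum_j (fun y => c j y *: b j)); last first.
  by apply/funext => y; rewrite fct_sumE.
rewrite derive_sum; last first.
  by move=> j; apply: diff_derivable; exact: differentiableZl.
apply: eq_bigr => j _; rewrite deriveE; last exact: differentiableZl.
by rewrite diffZl // deriveE.
Qed.

Lemma derive_comp_lincomb V U W n (b : 'I_n -> U) (c : 'I_n -> V -> R)
    (f : U -> W) x v :
  (forall j, differentiable (c j) x) ->
  differentiable f (\sum_j c j x *: b j) ->
  'D_v (fun y => f (\sum_j c j y *: b j)) x =
  \sum_j 'D_v (c j) x *: 'D_(b j) f (\sum_j c j x *: b j).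
Proof.
move=> dc df; have dl := differentiable_lincomb b dc.
have -> : (fun y => f (\sum_j c j y *: b j)) = f \o (fun y => \sum_j c j y *: b j) by [].
rewrite deriveE; last exact: differentiable_comp.
rewrite diff_comp //= -(deriveE v dl) derive_lincomb // linear_sum.
apply: eq_bigr => j _; by rewrite linearZ /= (deriveE _ df).
Qed.

(** The chain rule for a map written in coordinates as a sum of [c j x *: b j]:
    the partial derivatives of [f] along the [b j] are again evaluated along the
    same map, so the induction on [k] closes without iterated differentials. *)
Lemma Ck_on_comp_lincomb V U W k n (b : 'I_n -> U) (c : 'I_n -> V -> R)
    (f : U -> W) (A : set V) (B : set U) : open A ->
  (forall j, Ck_on k A (c j)) ->
  (forall x, A x -> B (\sum_j c j x *: b j)) ->
  Ck_on k B f -> Ck_on k A (fun x => f (\sum_j c j x *: b j)).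
Proof.
move=> oA; elim: k f => [|k IH] f cC AB fC.
  move=> x Ax; pose l y := \sum_j c j y *: b j.
  apply: (@continuous_comp _ _ _ l f); last exact/fC/AB.
  exact: (Ck_on_sum oA (fun j => Ck_onZ oA (cC j) (Ck_on_cst 0 A (b j)))).
have [df Df] := fC.
have dc x j : A x -> differentiable (c j) x by move=> Ax; exact: (cC j).1.
split=> [x Ax|v].
  apply: (@differentiable_comp _ _ _ _ (fun y => \sum_j c j y *: b j)).
    by apply: differentiable_lincomb => j; exact: dc.
  exact/df/AB.
apply: (@Ck_on_ext _ _ _ _
  (fun x => \sum_j 'D_v (c j) x *: 'D_(b j) f (\sum_j c j x *: b j))) => //.
  move=> x Ax /=; rewrite derive_comp_lincomb // => [j|]; first exact: dc.
  exact/df/AB.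
apply: (Ck_on_sum oA) => j; apply: (Ck_onZ oA); first exact: (cC j).2.
exact: (IH _ (fun i => Ck_onW (cC i)) AB (Df (b j))).
Qed.

Lemma Ck_on_id V k (A : set V) : Ck_on k A (@id V).
Proof.
case: k => [x _|k]; first exact: cvg_id.
split=> [x _|v]; first exact: (@ex_diff _ _ _ _ _ _ _ (is_diff_id x)).
have -> : (fun x => 'D_v id x) = (fun=> v) :> (V -> V).
  by apply/funext => x; exact: derive_id.
exact: Ck_on_cst.
Qed.

Lemma Ck_on_lincomb V U k n (b : 'I_n -> U) (c : 'I_n -> V -> R) (A : set V) :
  open A -> (forall j, Ck_on k A (c j)) ->
  Ck_on k A (fun x => \sum_j c j x *: b j).
Proof.
move=> oA cC; apply: (Ck_on_comp_lincomb (f := id) (B := setT)) => //.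
exact: Ck_on_id.
Qed.

Lemma Ck_on_comp_real W k (c : R -> R) (f : R -> W) (A B : set R) : open A ->
  Ck_on k A c -> (forall x, A x -> B (c x)) -> Ck_on k B f ->
  Ck_on k A (fun x => f (c x)).
Proof.
move=> oA cC AB fC.
have E x : \sum_(j < 1) c x *: (1 : R) = c x by rewrite big_ord1 [_ *: _]mulr1.
have := @Ck_on_comp_lincomb R R W k 1 (fun=> 1) (fun=> c) f A B oA (fun=> cC).
move=> /(_ _ fC) H; apply: (Ck_on_ext oA) (H _) => x Ax; rewrite E //.
exact: AB.
Qed.

Lemma Ck_on_mx_entry V k m n (A : set V) (F : V -> 'M[R]_(m, n)) i j : open A ->
  Ck_on k A F -> Ck_on k A (fun x => F x i j).
Proof.
move=> oA; elim: k F => [F FC x Ax|k IH F [dF DF]].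
  by apply: (@continuous_comp _ _ _ F (fun M : 'M[R]_(m, n) => M i j));
    [exact: FC|exact: coord_continuous].
split=> [x Ax|v].
  apply: (@differentiable_comp _ _ _ _ F (fun M : 'M[R]_(m, n) => M i j)).
    exact: dF.
  exact: differentiable_coord.
apply: (Ck_on_ext oA) (IH _ (DF v)) => x Ax.
by rewrite derive_mx ?mxE //; exact/diff_derivable/dF.
Qed.

End smooth_calculus.

(** * A smooth step function *)

Section smooth_step.
Context {R : realType}.

(** The bootstrap step for solutions of differential equations: they have one
    more derivative than the right-hand side. *)
Lemma Ck_on_primitive (W : normedModType R) k (A : set R) (f f' : R -> W) :
  open A -> (forall x, A x -> is_derive x 1 f (f' x)) ->
  Ck_on k A f' -> Ck_on k.+1 A f.
Proof.
move=> oA ff' fC.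
have df x : A x -> differentiable f x.
  by move=> /ff'[/derivable1_diffP].
split=> // v; apply: (Ck_on_ext oA) (Ck_onZ oA (Ck_on_cst k A v) fC) => x Ax.
rewrite (deriveE _ (df _ Ax)) -[X in 'd _ _ X]mulr1 linearZ.
by rewrite -(deriveE _ (df _ Ax)); have [_ ->] := ff' _ Ax.
Qed.

(** The functions x^-n exp(-1/x), extended by 0: this family, rather than the
    single function with n = 0, is stable under differentiation up to linear
    combinations. *)
Definition flat (n : nat) (x : R) : R :=
  if 0 < x then x ^- n * expR (- x^-1) else 0.

Lemma flat_le0 n x : x <= 0 -> flat n x = 0.
Proof. by rewrite /flat leNgt => /negbTE ->. Qed.

Lemma flat_ge0 n x : 0 <= flat n x.
Proof.
rewrite /flat; case: ifP => // x0.
by rewrite mulr_ge0 ?expR_ge0 // invr_ge0 exprn_ge0 // ltW.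
Qed.

Lemma flat_gt0 n x : 0 < x -> 0 < flat n x.
Proof. by move=> x0; rewrite /flat x0 mulr_gt0 ?expR_gt0 // invr_gt0 exprn_gt0. Qed.

(** A quadratic bound forces the derivative at 0 to vanish; it comes from the
    term of degree n + 2 in the exponential series at 1/x. *)
Lemma flat_le_sqr n x : flat n x <= n.+2`!%:R * x ^+ 2.
Proof.
rewrite /flat; case: ifP => x0; last by rewrite mulr_ge0 ?sqr_ge0.
have y0 : 0 < x^-1 by rewrite invr_gt0.
have := expR_ge1Dxn n.+1 (ltW y0).
set F := (n.+2)`!%:R : R; have F0 : 0 < F by rewrite ltr0n fact_gt0.
move=> le1; have le2 : x^-1 ^+ n.+2 / F <= expR x^-1 by apply: le_trans le1; lra.
rewrite expRN ler_pdivrMr ?expR_gt0 //.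
have xn0 : 0 < x ^+ n by rewrite exprn_gt0.
have -> : x ^- n = F * x ^+ 2 * (x^-1 ^+ n.+2 / F).
  have -> : x^-1 ^+ n.+2 = (x ^+ n)^-1 * (x^-1 * x^-1) by rewrite -exprVn !exprSr mulrA.
  field; rewrite !gt_eqF //.
by rewrite ler_pM2l // mulr_gt0 // exprn_gt0.
Qed.

Lemma is_derive_flat n (x : R) :
  is_derive x 1 (flat n) (flat n.+2 x - n%:R * flat n.+1 x).
Proof.
case: (ltgtP x 0) => [x0|x0|->].
- rewrite !flat_le0 ?ltW //.
  apply: (@near_eq_is_derive _ _ _ (cst 0)).
    near=> y; rewrite flat_le0 //; apply: ltW; near: y; exact: lt_nbhsl.
  by apply: is_derive_eq; rewrite mulr0 subrr.
- have xn0 : x != 0 by rewrite gt_eqF.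
  apply: (@near_eq_is_derive R R R (fun y : R => y ^- n * expR (- y^-1))).

    near=> y; rewrite /flat ifT //; near: y; exact: lt_nbhsr.
  have d1 : is_derive x 1 (fun y : R => y^-1) (- x ^- 2).
    apply: DeriveDef; first exact: derivableV.
    by rewrite deriveV // derive_id [_ *: _]mulr1.
  have d2 : is_derive x 1 (fun y : R => y ^- n) (- (n%:R * x ^- n.+1)).
    apply: DeriveDef.
      by apply: derivableV; [rewrite expf_neq0|exact: exprn_derivable].
    rewrite deriveV; [|by rewrite expf_neq0|exact: exprn_derivable].
    rewrite exp_derive.
    case: (n) => [|m]; first by rewrite /= mul0r oppr0 !scale0r scaler0.
    rewrite /= /GRing.scale /= !mulr1 !exprS; field.
    by rewrite xn0 expf_neq0.
  have d3 : is_derive x 1 (fun y : R => expR (- y^-1)) (x ^- 2 * expR (- x^-1)).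
    have d4 : is_derive x 1 (fun y : R => - y^-1) (x ^- 2).
      by apply: is_derive_eq; rewrite opprK.
    have := @is_derive1_comp _ expR (fun y : R => - y^-1) x _ _ (is_derive_expR _) d4.
    by rewrite mulrC.
  have := is_deriveM d2 d3.
  move/is_derive_eq; apply.
  rewrite /flat x0 /GRing.scale /= !exprS; field.
  by rewrite xn0 expf_neq0.
- rewrite !flat_le0 // mulr0 subrr.
  have cv : (h^-1 *: (flat n (h *: 1 + 0) - flat n 0) : R) @[h --> (0:R)^'] --> (0 : R).
    have F0 : 0 < (n.+2)`!%:R :> R by rewrite ltr0n fact_gt0.
    apply/cvgr0Pnorm_le => e e0; near=> h.
    have h0 : h != 0 by near: h; exact: nbhs_dnbhs_neq.
    have hh0 : 0 < `|h| by rewrite normr_gt0.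
    rewrite addr0 [_ *: 1]mulr1 [flat n 0]flat_le0 // subr0 normrM normfV.
    rewrite ler_pdivrMl // ger0_norm ?flat_ge0 //.
    apply: (le_trans (flat_le_sqr _ _)).
    rewrite -real_normK ?num_real // expr2 mulrCA ler_pM2l //.
    rewrite -ler_pdivlMl //.
    near: h; apply: dnbhs0_le; first by rewrite mulr_gt0 ?invr_gt0.
  apply: DeriveDef; first by apply/cvg_ex; exists 0.
  exact: cvg_lim cv.
Unshelve. all: by end_near. Qed.

Lemma Ck_on_flat k n : Ck_on k setT (flat n).
Proof.
elim: k n => [|k IH] n.
  move=> x _; apply: differentiable_continuous.
  by have [/derivable1_diffP] := is_derive_flat n x.
apply: Ck_on_primitive (fun x _ => is_derive_flat n x) _ => //; first exact: openT.
apply: (Ck_onB openT) => //; apply: (Ck_onM openT) => //; exact: Ck_on_cst.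
Qed.

(** The usual quotient of flat functions, 0 up to [s] and 1 from [u] on. *)
Definition step (s u t : R) : R :=
  flat 0 (t - s) / (flat 0 (t - s) + flat 0 (u - t)).

Lemma step_den_gt0 s u t : s < u -> 0 < flat 0 (t - s) + flat 0 (u - t).
Proof.
move=> su; case: (ltP s t) => st.
  by rewrite ltr_pwDl ?flat_ge0 // flat_gt0 // subr_gt0.
by rewrite ltr_wpDl ?flat_ge0 // flat_gt0 // subr_gt0 (le_lt_trans st).
Qed.

Lemma step_left s u t : t <= s -> step s u t = 0.
Proof. by move=> ts; rewrite /step flat_le0 ?mul0r // subr_le0. Qed.

Lemma step_right s u t : s < u -> u <= t -> step s u t = 1.
Proof.
move=> su ut; have := step_den_gt0 t su.
rewrite /step [flat 0 (u - t)]flat_le0 ?subr_le0 // addr0 => d0.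
by rewrite divff // gt_eqF.
Qed.

Lemma step_itv s u t : s < u -> 0 <= step s u t <= 1.
Proof.
move=> su; have d0 := step_den_gt0 t su.
by rewrite divr_ge0 ?flat_ge0 ?(ltW d0) //= ler_pdivrMr // mul1r lerDl flat_ge0.
Qed.

Lemma smooth_step s u : s < u -> smooth_on setT (step s u).
Proof.
move=> su k.
have flatC (c : R -> R) : Ck_on k setT c -> Ck_on k setT (fun t => flat 0 (c t)).
  by move=> cC; apply: (Ck_on_comp_real openT cC (B := setT)) => //; exact: Ck_on_flat.
have Fs : Ck_on k setT (fun t => flat 0 (t - s)).
  by apply/flatC/(Ck_onB openT); [exact: Ck_on_id|exact: Ck_on_cst].
have Fu : Ck_on k setT (fun t => flat 0 (u - t)).
  by apply/flatC/(Ck_onB openT); [exact: Ck_on_cst|exact: Ck_on_id].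
apply: (Ck_onM openT) => //; apply: (Ck_on_inv openT); last exact: Ck_onD openT _ _.
by move=> t _; rewrite gt_eqF // step_den_gt0.
Qed.

End smooth_step.

(** * Scalar ordinary differential equations *)

Section scalar_ode.
Context {R : realType}.
Implicit Types (h z : R -> R) (H : R -> R -> R).

Lemma MVT_le (f df : R -> R) (a b m : R) : continuous f ->
  (forall t : R, a < t < b -> is_derive t 1 f (df t)) ->
  (forall t, a < t < b -> `|df t| <= m) ->
  a <= b -> `|f b - f a| <= m * (b - a).
Proof.
move=> fc fd dfm; rewrite le_eqVlt => /orP[/eqP ->|ab].
  by rewrite !subrr normr0 mulr0.
have [t tab ->] := @MVT _ f df a b ab fd (continuous_subspaceT fc).
by rewrite normrM [`|b - a|]gtr0_norm ?subr_gt0 // ler_pM2r ?subr_gt0 // dfm.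
Qed.

Lemma MVT_le0 (f df : R -> R) (c m : R) : 0 < c -> continuous f ->
  (forall t : R, `|t| < c -> is_derive t 1 f (df t)) ->
  (forall t, `|t| < c -> `|df t| <= m) ->
  forall t, `|t| <= c -> `|f t - f 0| <= m * c.
Proof.
move=> c0 fc fd dfm t tc.
have m0 : 0 <= m by apply: le_trans (dfm 0 _); rewrite ?normr0.
have [t0|t0] := leP 0 t.
  have tc' : t <= c by apply: le_trans tc; exact: ler_norm.
  apply: (@le_trans _ _ (m * (t - 0))); last by rewrite subr0 ler_wpM2l.
  apply: (@MVT_le f df) => // s /andP[s0 st].
    by apply: fd; rewrite gtr0_norm // (lt_le_trans st).
  by apply: dfm; rewrite gtr0_norm // (lt_le_trans st).
have tc' : - t <= c by rewrite -(ltr0_norm t0).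
apply: (@le_trans _ _ (m * (0 - t))); last by rewrite sub0r ler_wpM2l.
rewrite distrC; apply: (@MVT_le f df) => //; last exact: ltW.
  by move=> s /andP[ts s0]; apply: fd; rewrite ltr0_norm // (lt_le_trans _ tc') // ltrN2.
by move=> s /andP[ts s0]; apply: dfm; rewrite ltr0_norm // (lt_le_trans _ tc') // ltrN2.
Qed.

Lemma antiderivative (c : R) h : continuous h ->
  exists P, P 0 = 0 /\ forall t : R, `|t| < c -> is_derive t 1 P (h t).
Proof.
move=> hc; pose F x := (\int[lebesgue_measure]_(t in [set` `[- c, x]]) (h t))%R.
exists (fun x => F x - F 0); split; first by rewrite subrr.
move=> t; rewrite ltr_norml => /andP[ct tc].
have ih : lebesgue_measure.-integrable `[- c, c] (EFin \o h).
  apply: continuous_compact_integrable; first exact: segment_compact.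
  exact: continuous_subspaceT.
have [dF FE] := continuous_FTC1_closed tc ih ct (hc t).
have {FE}dF' : is_derive t 1 F (h t) by rewrite -FE derive1E; exact/derivableP.
by apply: is_derive_eq; rewrite subr0.
Qed.

(** Projection of the line onto the interval [-c, c]. Composing with it turns
    local Lipschitz bounds into global ones, and keeps Picard iterates defined
    and continuous on the whole line. *)
Definition clamp (c t : R) : R := Num.max (- c) (Num.min c t).

Lemma clamp_norm c t : 0 <= c -> `|clamp c t| <= c.
Proof.
move=> c0; rewrite ler_norml /clamp le_max lexx ge_max ge_min lexx /=.
by rewrite andbT; lra.
Qed.

Lemma clamp_id c t : `|t| <= c -> clamp c t = t.
Proof.
rewrite ler_norml /clamp => /andP[ct tc].
by rewrite min_r // max_r.
Qed.

Lemma clamp_lip c s t : `|clamp c s - clamp c t| <= `|s - t|.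
Proof.
have h1 := ler_norm (s - t); have h2 := ler_norm (t - s).
rewrite (distrC t s) in h2; rewrite ler_norml /clamp.
rewrite !minEle !maxElt.
case: (leP c s) => ?; case: (leP c t) => ?; do 2![case: ltP => ?];
  by apply/andP; split; lra.
Qed.

Lemma continuous_clamp c : continuous (clamp c).
Proof.
move=> t.
apply: (@continuous_max _ _ (cst (- c)) (fun s : R => Num.min c s)).
  exact: cvg_cst.
by apply: (@continuous_min _ _ (cst c) id); [exact: cvg_cst|exact: cvg_id].
Qed.

Lemma geometric_small (C e : R) : 0 <= C -> 0 < e -> exists n, C / 2 ^+ n <= e.
Proof.
move=> C0 e0; have C1 : 0 <= C / e by rewrite divr_ge0 // ltW.
exists (Num.bound (C / e)); rewrite ler_pdivrMr ?exprn_gt0 //.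
rewrite -ler_pdivrMl // mulrC; apply: (le_trans (ltW (archi_boundP C1))).
by rewrite -natrX ler_nat ltnW // ltn_expl.
Qed.

(** The limit is the supremum of the increasing sequence of lower bounds
    [u n - 2 * C / 2 ^+ n]. *)
Lemma geometric_limit (u : nat -> R) (C : R) :
  (forall n, `|u n.+1 - u n| <= C / 2 ^+ n) ->
  exists l, forall n, `|u n - l| <= 2 * C / 2 ^+ n.
Proof.
move=> uC.
pose a n := u n - 2 * C / 2 ^+ n; pose b n := u n + 2 * C / 2 ^+ n.
have halfE n : 2 * C / 2 ^+ n.+1 = C / 2 ^+ n :> R.
  by rewrite exprS; field; rewrite expf_neq0.
have aS n : a n <= a n.+1.
  by rewrite /a halfE; have := uC n; rewrite ler_norml => /andP[+ _]; lra.
have bS n : b n.+1 <= b n.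
  by rewrite /b halfE; have := uC n; rewrite ler_norml => /andP[_ +]; lra.
have aM n m : (n <= m)%N -> a n <= a m.
  elim: m => [|m IH]; first by rewrite leqn0 => /eqP->.
  by rewrite leq_eqVlt ltnS => /orP[/eqP->//|/IH/le_trans]; apply.
have bM n m : (n <= m)%N -> b m <= b n.
  elim: m => [|m IH]; first by rewrite leqn0 => /eqP->.
  by rewrite leq_eqVlt ltnS => /orP[/eqP->//|/IH]; exact: le_trans.
have C0 : 0 <= C by have := le_trans (normr_ge0 _) (uC 0); rewrite expr0 divr1.
have ab n : a n <= b n.
  have : 0 <= C / 2 ^+ n by rewrite divr_ge0 // exprn_ge0.
  by rewrite /a /b; lra.
have abM n m : a n <= b m.
  by have [/aM/le_trans|/ltnW/bM] := leqP n m; [apply|exact: le_trans].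
have A0 : range a !=set0 by exists (a 0); exists 0.
have Ab m : ubound (range a) (b m) by move=> _ [n _ <-].
have l1 n : a n <= sup (range a) by apply: ub_le_sup; [exists (b 0)|exists n].
have l2 n : sup (range a) <= b n by exact: ge_sup.
exists (sup (range a)) => n; rewrite ler_norml.
have := l1 n; have := l2 n; rewrite /a /b; set s := sup _; move: (_ / _) => e; lra.
Qed.

Lemma continuous_uniform_limit (T : topologicalType) (u : nat -> T -> R)
    (z : T -> R) (C : R) :
  (forall n, continuous (u n)) ->
  (forall n t, `|u n t - z t| <= C / 2 ^+ n) -> continuous z.
Proof.
move=> uc uz t; apply/cvgrPdist_le => e e0.
have C0 : 0 <= C by have := le_trans (normr_ge0 _) (uz 0 t); rewrite expr0 divr1.
have [n Cn] := geometric_small C0 (divr_gt0 e0 (ltr0n R 3 : 0 < 3)).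
have := uc n t => /cvgrPdist_le /(_ (e / 3)); rewrite divr_gt0 // => /(_ isT).
apply: filterS => s us.
have := uz n t; have := uz n s.
move: us Cn; move: (C / _) => q us Cn /ler_normlP[? ?] /ler_normlP[? ?].
by apply/ler_normlP; move/ler_normlP: us => [? ?]; split; lra.
Qed.

Section picard.
Variables (H : R -> R -> R) (z0 : R).
Hypothesis Hc : forall z, continuous z -> continuous (fun t => H t (z t)).
Hypothesis Hlip : forall t w w', `|t| <= 2 -> `|H t w - H t w'| <= 8^-1 * `|w - w'|.

(** Picard iteration. The Lipschitz constant 1/8 on an interval of half-length 2
    makes the integral operator contract distances by 1/4, so that no local
    existence argument is needed: all the equations considered later come from
    short curves, and have small constants. *)
Lemma picard : exists z, [/\ continuous z, z 0 = z0 &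
  forall t : R, `|t| < 2 -> is_derive t 1 z (H t (z t))].
Proof.
(* Antiderivatives on ]-3, 3[ and not ]-2, 2[: clamping takes the values -2 and 2,
   where continuity is needed. *)
have /choice[Pr PrP] : forall h, exists P : R -> R, continuous h ->
    P 0 = 0 /\ forall t : R, `|t| < 3 -> is_derive t 1 P (h t).
  move=> h; have [hc|hc] := pselect (continuous h).
    by have [P PP] := antiderivative 3 hc; exists P.
  by exists h.
pose T z t := z0 + Pr (fun s => H s (z s)) (clamp 2 t).
have Tc z : continuous z -> continuous (T z).
  move=> /Hc/PrP[_ dP] t; apply: continuousD; first exact: cvg_cst.
  apply: continuous_comp; first exact: continuous_clamp.
  apply: differentiable_continuous; apply/derivable1_diffP.
  have c3 : `|clamp 2 t| < 3 by apply: (@le_lt_trans _ _ 2); [exact: clamp_norm|lra].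
  by have [] := dP _ c3.
have Td z (t : R) : continuous z -> `|t| < 2 -> is_derive t 1 (T z) (H t (z t)).
  move=> /Hc/PrP[_ dP] t2.
  apply: (@near_eq_is_derive R R R (fun t => z0 + Pr (fun s => H s (z s)) t)).
    move: (t2); rewrite ltr_norml => /andP[t2l t2r].
    near=> s; rewrite /T clamp_id // ltW // ltr_norml.
    by apply/andP; split; near: s; [exact: lt_nbhsr|exact: lt_nbhsl].
  have dPt := dP t (lt_trans t2 (ltr_nat R 2 3)).
  have := is_deriveD (is_derive_cst z0 t 1) dPt.
  by rewrite add0r.
have T0 z : continuous z -> T z 0 = z0.
  by move=> /Hc/PrP[P0 _]; rewrite /T clamp_id ?normr0 // P0 addr0.
have Tclamp z t : T z (clamp 2 t) = T z t.
  by rewrite /T [clamp 2 (clamp 2 t)]clamp_id // clamp_norm.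
have Tctr (z w : R -> R) (m : R) : continuous z -> continuous w ->
    (forall t, `|z t - w t| <= m) -> forall t, `|T z t - T w t| <= m / 2.
  move=> zc wc zw t; rewrite -(Tclamp z) -(Tclamp w).
  have m0 : 0 <= m by apply: le_trans (zw 0).
  have := @MVT_le0 (T z - T w) (fun t => H t (z t) - H t (w t)) 2 (8^-1 * m).
  move=> /(_ _ _ _ _ (clamp 2 t)) B.
  apply: (@le_trans _ _ (8^-1 * m * 2)); last lra.
  have -> : T z (clamp 2 t) - T w (clamp 2 t) = (T z - T w) (clamp 2 t) - (T z - T w) 0.
    by rewrite !fctE /= !T0 // subrr subr0.
  apply: B => //.
  - by move=> s; apply: continuousB; exact: Tc.
  - by move=> s s2; apply: is_deriveB; exact: Td.
  - move=> s s2; apply: (le_trans (Hlip _ _ (ltW s2))).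
    by rewrite ler_pM2l.
  - exact: clamp_norm.
pose u n := iter n T (cst z0).
have uc n : continuous (u n).
  by elim: n => [|n IH]; [exact: cst_continuous|exact: Tc].
have [C uC] : exists C, forall t, `|u 1 t - u 0 t| <= C.
  have gc : continuous (fun t => `|u 1%N t - u 0%N t|).
    move=> t; apply: (@continuous_comp _ _ _ (fun t => u 1%N t - u 0%N t) Num.norm).
      by apply: continuousB; exact: uc.
    exact: norm_continuous.
  have h22 : - 2 <= 2 :> R by lra.
  have [c _ cM] := EVT_max h22 (continuous_subspaceT gc).
  exists `|u 1%N c - u 0%N c| => t.
  have := cM (clamp 2 t); rewrite in_itv /= -ler_norml clamp_norm // => /(_ isT).
  by rewrite /= Tclamp.
have uS n t : `|u n.+1 t - u n t| <= C / 2 ^+ n.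
  elim: n t => [|n IH] t; first by rewrite expr0 divr1.
  rewrite exprSr invfM mulrA; exact: (Tctr (u n.+1) (u n) _ (uc _) (uc _) IH).
have /choice[z zu] : forall t, exists l, forall n, `|u n t - l| <= 2 * C / 2 ^+ n.
  by move=> t; apply: (geometric_limit (u := fun n => u n t)) => n; exact: uS.
have zc : continuous z.
  by apply: (continuous_uniform_limit (u := u) (C := 2 * C)) => // n t; exact: zu.
have Tz t : T z t = z t.
  apply/eqP; rewrite -subr_eq0 -normr_le0; apply/ler_addgt0Pl => e e0; rewrite addr0.
  have C0 : 0 <= 4 * C by rewrite mulr_ge0 // (le_trans (normr_ge0 _) (uC 0)).
  have [n Cn] := geometric_small C0 e0; apply: le_trans Cn.
  have := Tctr _ _ _ (uc n) zc (fun t => zu t n) t; have := zu t n.+1.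
  rewrite exprS invfM; set q := 2 ^- n; rewrite -[T (u n) t]/(u n.+1 t).
  by rewrite !ler_norml; lra.
exists z; split => //; first by rewrite -Tz T0.
move=> t t2; have : T z = z by apply/funext.
by move=> E; rewrite -{1}E; exact: Td.
Unshelve. all: by end_near. Qed.

End picard.

(** The same contraction estimate, at a point where the distance [`|z t - w t|]
    is largest, replaces the Gronwall inequality. *)
Lemma ode_stability (H G : R -> R -> R) (z w : R -> R) (b : R) :
  continuous z -> continuous w ->
  (forall t : R, `|t| < 2 -> is_derive t 1 z (H t (z t))) ->
  (forall t : R, `|t| < 2 -> is_derive t 1 w (G t (w t))) ->
  (forall t x y, `|t| <= 2 -> `|H t x - H t y| <= 8^-1 * `|x - y|) ->
  (forall t, `|t| <= 2 -> `|H t (w t) - G t (w t)| <= b) ->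
  forall t, `|t| <= 2 -> `|z t - w t| <= 2 * `|z 0 - w 0| + 4 * b.
Proof.
move=> zc wc dz dw Hlip HG.
have dc : continuous (z - w) by move=> s; apply: continuousB; [exact: zc|exact: wc].
have gc : continuous (fun t => `|z t - w t|).
  move=> t; apply: (@continuous_comp _ _ _ (z - w) Num.norm); first exact: dc.
  exact: norm_continuous.
have h22 : - 2 <= 2 :> R by lra.
have [c /[!in_itv]/= c2 cM] := EVT_max h22 (continuous_subspaceT gc).
rewrite -ler_norml in c2.
have {}cM t : `|t| <= 2 -> `|z t - w t| <= `|z c - w c|.
  by move=> t2; apply: cM; rewrite in_itv /= -ler_norml.
set m := `|z c - w c| in cM *.
have : `|(z - w) c - (z - w) 0| <= (8^-1 * m + b) * 2.
  apply: (@MVT_le0 _ (fun t => H t (z t) - G t (w t))) => //.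
    by move=> s s2; apply: is_deriveB; [exact: dz|exact: dw].
  move=> s /ltW s2; rewrite -(subrKA (H s (w s))).
  apply: (le_trans (ler_normD _ _)); apply: lerD; last exact: HG.
  by apply: (le_trans (Hlip _ _ _ s2)); rewrite ler_pM2l // cM.
rewrite !fctE /= => B.
have := ler_normB (z c - w c - (z 0 - w 0)) (- (z 0 - w 0)).
rewrite opprK subrK normrN -/m => B'.
have := normr_ge0 (z 0 - w 0).
have b0 : 0 <= b by apply: le_trans (HG 0 _); rewrite ?normr0.
move=> B0 t t2; apply: (le_trans (cM t t2)); lra.
Qed.

End scalar_ode.

(** * Lifting plane loops to curves tangent to a plane field *)

Section horizontal_lift.
Context {R : realType}.

Definition lipschitz3 (K : R) (h : R -> R -> R -> R) := forall x y z x' y' z',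
  `|h x y z - h x' y' z'| <= K * (`|x - x'| + `|y - y'| + `|z - z'|).

(** First-order expansion at the origin, where [h] vanishes. *)
Definition linearized0 (h : R -> R -> R -> R) (hx hy hz : R) :=
  forall eps : R, 0 < eps -> exists2 d : R, 0 < d & forall x y z,
    `|x| <= d -> `|y| <= d -> `|z| <= d ->
    `|h x y z - (hx * x + hy * y + hz * z)| <= eps * (`|x| + `|y| + `|z|).

Variables (f g : R -> R -> R -> R) (K : R).
Hypothesis K0 : 0 <= K.
Hypothesis f_lip : lipschitz3 K f.
Hypothesis g_lip : lipschitz3 K g.
Hypothesis f0 : f 0 0 0 = 0.
Hypothesis g0 : g 0 0 0 = 0.

(** The velocity is carried along with the curve, so that lifting conditions
    and estimates do not mention derivatives. *)
Record plane_curve := PlaneCurve {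
  pc_x : R -> R ; pc_y : R -> R ; pc_dx : R -> R ; pc_dy : R -> R }.

Definition pc_bounded (m : R) (c : plane_curve) := forall t, `|t| <= 2 ->
  [/\ `|pc_x c t| <= m, `|pc_y c t| <= m, `|pc_dx c t| <= m & `|pc_dy c t| <= m].

(** The right-hand side of z' = f x' + g y'. *)
Definition lift_field (c : plane_curve) (t z : R) : R :=
  f (pc_x c t) (pc_y c t) z * pc_dx c t + g (pc_x c t) (pc_y c t) z * pc_dy c t.

Definition is_lift (c : plane_curve) (z : R -> R) := continuous z /\
  forall t : R, `|t| < 2 -> is_derive t 1 z (lift_field c t (z t)).

Lemma norm_mulD_le (a b c d A C : R) :
  `|a| <= A -> `|b| <= A -> `|c| <= C -> `|d| <= C ->
  `|a * c + b * d| <= 2 * A * C.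
Proof.
move=> aA bA cC dC; apply: (le_trans (ler_normD _ _)); rewrite !normrM.
have := ler_pM (normr_ge0 _) (normr_ge0 _) aA cC.
have := ler_pM (normr_ge0 _) (normr_ge0 _) bA dC.
lra.
Qed.

Lemma lift_field_lip c m t x y : pc_bounded m c -> 16 * K * m <= 1 -> `|t| <= 2 ->
  `|lift_field c t x - lift_field c t y| <= 8^-1 * `|x - y|.
Proof.
move=> cm Km t2; have [_ _ dx dy] := cm t t2.
rewrite /lift_field opprD addrACA -!mulrBl.
have := f_lip (pc_x c t) (pc_y c t) x (pc_x c t) (pc_y c t) y.
have := g_lip (pc_x c t) (pc_y c t) x (pc_x c t) (pc_y c t) y.
rewrite !subrr !normr0 !add0r => gL fL.
apply: (le_trans (norm_mulD_le fL gL dx dy)).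
have := normr_ge0 (x - y); move: (`|x - y|) => u u0.
have -> : 2 * (K * u) * m = 8^-1 * (16 * K * m * u) by field.
by rewrite ler_pM2l // ler_piMl.
Qed.

Lemma lip0_le (h : R -> R -> R -> R) x y z m n :
  lipschitz3 K h ->
  h 0 0 0 = 0 -> `|x| <= m -> `|y| <= m -> `|z| <= n ->
  `|h x y z| <= K * (2 * m + n).
Proof.
move=> hl h0 xm ym zn; have := hl x y z 0 0 0; rewrite h0 !subr0.
by move/le_trans; apply; rewrite ler_wpM2l // mulr2n mulrDl mul1r !lerD.
Qed.

(** The case of [ode_stability] comparing with the zero solution of the zero
    field: up to the initial height, the lift is of second order in the size of
    the plane curve. *)
Lemma lift_bound c m z : pc_bounded m c -> 16 * K * m <= 1 -> is_lift c z ->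
  forall t, `|t| <= 2 -> `|z t| <= 2 * `|z 0| + 16 * K * m ^+ 2.
Proof.
move=> cm Km [zc dz] t t2.
have := @ode_stability R (lift_field c) (fun _ _ => 0) z (cst 0) (4 * K * m ^+ 2) zc.
move=> /(_ (@cst_continuous _ _ _) dz).
have d0 (s : R) : `|s| < 2 -> is_derive s 1 (cst 0 : R -> R) 0.
  by move=> _; exact: is_derive_cst.
move=> /(_ d0 (fun t x y => lift_field_lip x y cm Km)).
have bd s : `|s| <= 2 -> `|lift_field c s (cst 0 s) - 0| <= 4 * K * m ^+ 2.
  move=> s2; rewrite subr0; have [xm ym dxm dym] := cm s s2.
  have n00 : `|cst 0 s : R| <= 0 by rewrite normr0.
  have nf := lip0_le f_lip f0 xm ym n00; have ng := lip0_le g_lip g0 xm ym n00.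
  by apply: (le_trans (norm_mulD_le nf ng dxm dym)); lra.
move=> /(_ bd t t2); rewrite !subr0 => /le_trans; apply; lra.
Qed.

Definition pc_close (d : R) (c c' : plane_curve) := forall t, `|t| <= 2 ->
  [/\ `|pc_x c t - pc_x c' t| <= d, `|pc_y c t - pc_y c' t| <= d,
      `|pc_dx c t - pc_dx c' t| <= d & `|pc_dy c t - pc_dy c' t| <= d].

Lemma lift_stability c c' m d z w : m <= 1 -> 16 * K * m <= 1 ->
  pc_bounded m c -> pc_bounded m c' -> pc_close d c c' ->
  is_lift c z -> is_lift c' w -> (forall t, `|t| <= 2 -> `|w t| <= 1) ->
  forall t, `|t| <= 2 -> `|z t - w t| <= 2 * `|z 0 - w 0| + 40 * K * d.
Proof.
move=> m1 Km cm cm' cc' [zc dz] [wc dw] w1 t t2.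
have := @ode_stability R _ _ z w (10 * K * d) zc wc dz dw.
move=> /(_ (fun t x y => lift_field_lip x y cm Km)).
have bd s : `|s| <= 2 ->
    `|lift_field c s (w s) - lift_field c' s (w s)| <= 10 * K * d.
  move=> s2; have [xm ym dxm dym] := cm s s2; have [xm' ym' dxm' dym'] := cm' s s2.
  have [cx cy cdx cdy] := cc' s s2.
  have m0 : 0 <= m by exact: le_trans xm.
  have d0 : 0 <= d by exact: le_trans cx.
  have nf := lip0_le f_lip f0 xm' ym' (w1 s s2).
  have ng := lip0_le g_lip g0 xm' ym' (w1 s s2).
  have df := f_lip (pc_x c s) (pc_y c s) (w s) (pc_x c' s) (pc_y c' s) (w s).
  have dg := g_lip (pc_x c s) (pc_y c s) (w s) (pc_x c' s) (pc_y c' s) (w s).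
  have bd2 : K * (`|pc_x c s - pc_x c' s| + `|pc_y c s - pc_y c' s| + `|w s - w s|)
      <= K * (2 * d).
    by rewrite ler_wpM2l // subrr normr0 addr0; lra.
  have E1 := norm_mulD_le (le_trans df bd2) (le_trans dg bd2) dxm dym.
  have E2 := norm_mulD_le nf ng cdx cdy.
  have -> : lift_field c s (w s) - lift_field c' s (w s) =
    ((f (pc_x c s) (pc_y c s) (w s) - f (pc_x c' s) (pc_y c' s) (w s)) * pc_dx c s +
     (g (pc_x c s) (pc_y c s) (w s) - g (pc_x c' s) (pc_y c' s) (w s)) * pc_dy c s) +
    (f (pc_x c' s) (pc_y c' s) (w s) * (pc_dx c s - pc_dx c' s) +
     g (pc_x c' s) (pc_y c' s) (w s) * (pc_dy c s - pc_dy c' s)).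
    by rewrite /lift_field; ring.
  apply: (le_trans (ler_normD _ _)); apply: (le_trans (lerD E1 E2)).
  have Kd : 0 <= K * d by rewrite mulr_ge0.
  have : K * d * m <= K * d by rewrite ler_piMr.
  lra.
move=> /(_ bd t t2) /le_trans; apply; lra.
Qed.

Lemma continuous_lip3 (h : R -> R -> R -> R) (x y z : R -> R) :
  lipschitz3 K h ->
  continuous x -> continuous y -> continuous z ->
  continuous (fun t => h (x t) (y t) (z t)).
Proof.
move=> hl xc yc zc t; apply/cvgrPdist_le => e e0.
have cv : K * (`|x t - x s| + `|y t - y s| + `|z t - z s|) @[s --> t] -->
   K * (`|x t - x t| + `|y t - y t| + `|z t - z t|).
  by apply: cvgM; [exact: cvg_cst|apply: cvgD; first apply: cvgD];
    apply: cvg_norm; apply: cvgB; do ?[exact: cvg_cst|exact: xc|exact: yc|exact: zc].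
move: cv; rewrite !subrr !normr0 !addr0 mulr0 => cv.
near=> s; apply: (le_trans (hl _ _ _ _ _ _)).
by near: s; apply: cvgr_le cv _ e0.
Unshelve. all: by end_near. Qed.

Definition pc_continuous (c : plane_curve) :=
  [/\ continuous (pc_x c), continuous (pc_y c), continuous (pc_dx c) &
      continuous (pc_dy c)].

Lemma lift_exists c m z0 : pc_continuous c -> pc_bounded m c -> 16 * K * m <= 1 ->
  exists z, is_lift c z /\ z 0 = z0.
Proof.
move=> [xc yc dxc dyc] cm Km.
have := @picard R (lift_field c) z0.
case=> [z zc t|t w w' t2|z [zc z00 dz]]; last by exists z.
  move=> s; apply: cvgD; apply: cvgM; do ?[exact: dxc|exact: dyc].
    exact: (continuous_lip3 f_lip xc yc zc).
  exact: (continuous_lip3 g_lip xc yc zc).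
exact: lift_field_lip cm Km t2.
Qed.

(** A segment with velocity (dx, dy), plus the loop
    (s * (t - t^2), r * (t - t^2) * (1 - 2 t)), which closes up at t = 0 and
    t = 1. It encloses a signed area proportional to [s * r], which changes sign
    with [s]. *)
Definition loop_curve (x0 y0 dx dy r s : R) : plane_curve := PlaneCurve
  (fun t => x0 + t * dx + s * (t - t ^+ 2))
  (fun t => y0 + t * dy + r * (t - 3 * t ^+ 2 + 2 * t ^+ 3))
  (fun t => dx + s * (1 - 2 * t))
  (fun t => dy + r * (1 - 6 * t + 6 * t ^+ 2)).

Lemma loop_norms (t : R) : `|t| <= 2 ->
  [/\ `|t - t ^+ 2| <= 6, `|t - 3 * t ^+ 2 + 2 * t ^+ 3| <= 30,
      `|1 - 2 * t| <= 5 & `|1 - 6 * t + 6 * t ^+ 2| <= 37].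
Proof.
rewrite !ler_norml => /andP[t1 t2].
have tt0 : 0 <= t ^+ 2 by exact: sqr_ge0.
have h1 : 0 <= 2 - t by lra.
have h2 : 0 <= t + 2 by lra.
have tt : t ^+ 2 <= 4 by have := mulr_ge0 h1 h2; lra.
have h3 : 0 <= 4 + 2 * t + t ^+ 2 by nra.
have h4 : 0 <= 4 - 2 * t + t ^+ 2 by nra.
have t3 : t ^+ 3 <= 8 by have := mulr_ge0 h1 h3; lra.
have t3' : - 8 <= t ^+ 3 by have := mulr_ge0 h2 h4; lra.
by split; apply/andP; split; lra.
Qed.


Lemma is_derive_loop x0 y0 dx dy r s (t : R) :
  let c := loop_curve x0 y0 dx dy r s in
  is_derive t 1 (pc_x c) (pc_dx c t) /\ is_derive t 1 (pc_y c) (pc_dy c t).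
Proof.
split => /=.
  by apply: is_derive_eq; rewrite /GRing.scale /=; ring.
by apply: is_derive_eq; rewrite /GRing.scale /=; ring.
Qed.

Lemma loop_curve_smooth x0 y0 dx dy r s :
  let c := loop_curve x0 y0 dx dy r s in
  [/\ smooth_on setT (pc_x c), smooth_on setT (pc_y c),
      smooth_on setT (pc_dx c) & smooth_on setT (pc_dy c)].
Proof.
have smooth_poly (p : {poly R}) : smooth_on setT (horner p).
  move=> k; elim: k p => [p x _|k IH p]; first exact: continuous_horner.
  apply: Ck_on_primitive openT _ (IH p^`()) => x _; exact: is_derive_poly.
pose X := 'X : {poly R}.
split => /=.
- have := smooth_poly (x0%:P + X * dx%:P + s%:P * (X - X ^+ 2)); congr smooth_on.
  by apply/funext => t; rewrite !hornerE.
- have := smooth_poly (y0%:P + X * dy%:P + r%:P * (X - 3%:P * X ^+ 2 + 2%:P * X ^+ 3)).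
  by congr smooth_on; apply/funext => t; rewrite !hornerE.
- have := smooth_poly (dx%:P + s%:P * (1 - 2%:P * X)); congr smooth_on.
  by apply/funext => t; rewrite !hornerE.
- have := smooth_poly (dy%:P + r%:P * (1 - 6%:P * X + 6%:P * X ^+ 2)).
  by congr smooth_on; apply/funext => t; rewrite !hornerE.
Qed.

Lemma loop_curve_continuous x0 y0 dx dy r s : pc_continuous (loop_curve x0 y0 dx dy r s).
Proof.
have [h1 h2 h3 h4] := loop_curve_smooth x0 y0 dx dy r s.
by split=> t; [exact: (h1 0%N)|exact: (h2 0%N)|exact: (h3 0%N)|exact: (h4 0%N)].
Qed.

Lemma norm3_le (a b c d e A B C D E : R) :
  `|a| <= A -> `|b| <= B -> `|c| <= C -> `|d| <= D -> `|e| <= E ->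
  `|a + b * c + d * e| <= A + B * C + D * E.
Proof.
move=> aA bB cC dD eE.
have := ler_pM (normr_ge0 _) (normr_ge0 _) bB cC.
have := ler_pM (normr_ge0 _) (normr_ge0 _) dD eE.
rewrite -!normrM => h1 h2.
by rewrite (le_trans (ler_normD _ _)) // lerD // (le_trans (ler_normD _ _)) // lerD.
Qed.

Lemma loop_curve_bounded x0 y0 dx dy r s : `|x0| <= r -> `|y0| <= r -> `|dx| <= r ->
  `|dy| <= r -> `|s| <= r -> pc_bounded (40 * r) (loop_curve x0 y0 dx dy r s).
Proof.
move=> x0r y0r dxr dyr sr t t2; have [l1 l2 l3 l4] := loop_norms t2.
have r0 : 0 <= r by exact: le_trans x0r.
have rr : `|r| <= r by rewrite ger0_norm.
have n0 : `|0 : R| <= 0 by rewrite normr0.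
split => /=.
- by apply: le_trans (norm3_le x0r t2 dxr sr l1) _; lra.
- by apply: le_trans (norm3_le y0r t2 dyr rr l2) _; lra.
- by have := norm3_le dxr n0 n0 sr l3; rewrite mul0r addr0 => /le_trans; apply; lra.
- by have := norm3_le dyr n0 n0 rr l4; rewrite mul0r addr0 => /le_trans; apply; lra.
Qed.

Lemma loop_curve_close x0 y0 dx dy r s x0' y0' dx' dy' s' d :
  `|x0 - x0'| <= d -> `|y0 - y0'| <= d -> `|dx - dx'| <= d -> `|dy - dy'| <= d ->
  `|s - s'| <= d ->
  pc_close (9 * d) (loop_curve x0 y0 dx dy r s) (loop_curve x0' y0' dx' dy' r s').
Proof.
move=> x0d y0d dxd dyd sd t t2; have [l1 l2 l3 l4] := loop_norms t2.
have d0 : 0 <= d by exact: le_trans x0d.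
have n0 : `|0 : R| <= 0 by rewrite normr0.
split => /=.
- have -> : x0 + t * dx + s * (t - t ^+ 2) - (x0' + t * dx' + s' * (t - t ^+ 2)) =
    (x0 - x0') + t * (dx - dx') + (s - s') * (t - t ^+ 2) by ring.
  by apply: le_trans (norm3_le x0d t2 dxd sd l1) _; lra.
- set l := t - _ + _; have -> : y0 + t * dy + r * l - (y0' + t * dy' + r * l) =
    (y0 - y0') + t * (dy - dy') + 0 * 0 by ring.
  by apply: le_trans (norm3_le y0d t2 dyd n0 n0) _; lra.
- set l := 1 - _; have -> : dx + s * l - (dx' + s' * l) =
    (dx - dx') + 0 * 0 + (s - s') * l by ring.
  by apply: le_trans (norm3_le dxd n0 n0 sd l3) _; lra.
- set l := 1 - _ + _; have -> : dy + r * l - (dy' + r * l) =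
    (dy - dy') + 0 * 0 + 0 * 0 by ring.
  by apply: le_trans (norm3_le dyd n0 n0 n0 n0) _; lra.
Qed.

Variables fx fy fz gx gy gz : R.
Hypothesis f_diff : linearized0 f fx fy fz.
Hypothesis g_diff : linearized0 g gx gy gz.
Hypothesis curl : gx - fy != 0.

(* Besides the sign of K, only hypotheses reverted into the goal matter: clearing
   the others keeps lra fast. *)
Ltac arith := clear - K0 f_lip g_lip f0 g0 f_diff g_diff curl; intros; lra.

(** An antiderivative of (t - t^2) d(t - 3 t^2 + 2 t^3), the area form along the
    loop; its value at 1 is - 1 / 30. *)
Definition loop_area (t : R) : R :=
  2^-1 * t ^+ 2 - 7 / 3 * t ^+ 3 + 3 * t ^+ 4 - 6 / 5 * t ^+ 5.

Lemma is_derive_loop_area (t : R) :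
  is_derive t 1 loop_area ((t - t ^+ 2) * (1 - 6 * t + 6 * t ^+ 2)).
Proof.
by apply: is_derive_eq; rewrite /GRing.scale /=; field.
Qed.

(** The height obtained by lifting the loop through the linear parts of [f] and
    [g]. The terms in [fx] and [gy] are exact, hence invisible at t = 1. *)
Definition loop_primitive (r s t : R) : R :=
  let a := t - t ^+ 2 in
  let b := t - 3 * t ^+ 2 + 2 * t ^+ 3 in
  fx * s ^+ 2 / 2 * a ^+ 2 + fy * s * r * (a * b - loop_area t)
  + gx * s * r * loop_area t + gy * r ^+ 2 / 2 * b ^+ 2.

Lemma is_derive_loop_primitive r s (t : R) :
  let c := loop_curve 0 0 0 0 r s in
  is_derive t 1 (loop_primitive r s)
    ((fx * pc_x c t + fy * pc_y c t) * pc_dx c t +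
     (gx * pc_x c t + gy * pc_y c t) * pc_dy c t).
Proof.
have dq := is_derive_loop_area t.
by rewrite /loop_primitive; apply: is_derive_eq; rewrite /GRing.scale /=; field.
Qed.

Lemma loop_primitive01 r s :
  loop_primitive r s 1 - loop_primitive r s 0 = - ((gx - fy) * s * r / 30).
Proof. by rewrite /loop_primitive /loop_area /=; field. Qed.

(** The error terms are of order r^2 times a small factor: the linearization of
    [f] and [g] is accurate to first order, and the height, being itself of
    order r^2, contributes only at order r^3. *)
Lemma loop_displacement : exists2 r1, 0 < r1 & forall r, 0 < r -> r <= r1 ->
  forall s, `|s| = r -> forall z, is_lift (loop_curve 0 0 0 0 r s) z -> z 0 = 0 ->
  `|z 1 + (gx - fy) * s * r / 30| <= `|gx - fy| * r ^+ 2 / 60.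
Proof.
set k := `|gx - fy|; have k0 : 0 < k by rewrite normr_gt0.
pose M := 16 * K * (40 * 40); have M0 : 0 <= M by rewrite !mulr_ge0.
pose L := `|fz| + `|gz|; have L0 : 0 <= L by rewrite addr_ge0.
pose e := k / (96 * 100) / (80 + M); have M80 : 0 < 80 + M by lra.
have e0 : 0 < e by rewrite !divr_gt0.
have [d1 d10 fd] := f_diff e0; have [d2 d20 gd] := g_diff e0.
(* The first bound makes r^2 <= r; the next two keep the lift where the
   linearizations are valid; the last two ensure the contraction condition and
   the smallness of the cubic error. *)
pose r1 := Num.min 1 (Num.min (d1 / (40 + M)) (Num.min (d2 / (40 + M))
  (Num.min ((16 * 40) * K + 1)^-1 (k / (96 * 100) / (L * M + 1))))).
have M40 : 0 < 40 + M by lra.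
have LM : 0 < L * M + 1 by rewrite ltr_wpDl // mulr_ge0.
have K640 : 0 < (16 * 40) * K + 1 by rewrite ltr_wpDl // mulr_ge0.
exists r1; first by rewrite !lt_min ltr01 !divr_gt0 //= invr_gt0 K640.
move=> r r0; rewrite !le_min => /and5P[r1' rd1 rd2 rK rL] s sr z zl z0.
rewrite !ler_pdivlMr // in rd1 rd2 rL.
have rK1 : r * ((16 * 40) * K + 1) <= 1 by rewrite -ler_pdivlMr // div1r.
have n0 : `|0 : R| <= r by rewrite normr0 ltW.
have srle : `|s| <= r by rewrite sr.
have cb := loop_curve_bounded n0 n0 n0 n0 srle.
have Km : 16 * K * (40 * r) <= 1 by move: rK1 r0; arith.
have zb := lift_bound cb Km zl.
have rr : r ^+ 2 <= r by rewrite expr2 ler_piMr // ltW.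
have {}zb t : `|t| <= 2 -> `|z t| <= M * r ^+ 2.
  by move=> /zb /le_trans; apply; rewrite z0 normr0 /M; arith.
have [zc dz] := zl.
pose c := loop_curve 0 0 0 0 r s.
pose D t := lift_field c t (z t) - ((fx * pc_x c t + fy * pc_y c t) * pc_dx c t +
     (gx * pc_x c t + gy * pc_y c t) * pc_dy c t).
have t2 (t : R) : 0 < t < 1 -> `|t| < 2.
  by move=> /andP[t0 t1]; rewrite ger0_norm ?ltW //; move: t1; arith.
have zQc : continuous (z - loop_primitive r s).
  move=> t; apply: continuousB; first exact: zc.
  apply: differentiable_continuous; apply/derivable1_diffP.
  by have [] := is_derive_loop_primitive r s t.
have zQd (t : R) : 0 < t < 1 -> is_derive t 1 (z - loop_primitive r s) (D t).
  move=> t01; apply: is_deriveB; first exact/dz/t2.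
  exact: is_derive_loop_primitive.
have Db t : 0 < t < 1 -> `|D t| <= k * r ^+ 2 / 60.
  move=> /t2/ltW{}t2; have [xb yb dxb dyb] := cb t t2.
  have zt := zb t t2.
  have Mr : M * r ^+ 2 <= M * r by rewrite ler_wpM2l.
  set m := 40 * r in xb yb dxb dyb.
  have step (h : R -> R -> R -> R) hx hy hz d : d > 0 -> r * (40 + M) <= d ->
      `|hz| <= L ->
      (forall x y z, `|x| <= d -> `|y| <= d -> `|z| <= d ->
        `|h x y z - (hx * x + hy * y + hz * z)| <= e * (`|x| + `|y| + `|z|)) ->
      `|h (pc_x c t) (pc_y c t) (z t) - (hx * pc_x c t + hy * pc_y c t)| <=
      e * (2 * m + M * r) + L * M * r ^+ 2.
    move=> d0 rd hzL hd.
    have Mr0 : 0 <= M * r by rewrite mulr_ge0 // ltW.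
    have xd : `|pc_x c t| <= d by apply: (le_trans xb); rewrite /m; move: rd Mr0; arith.
    have yd : `|pc_y c t| <= d by apply: (le_trans yb); rewrite /m; move: rd Mr0; arith.
    have zd : `|z t| <= d by apply: (le_trans zt); move: rd Mr r0; arith.
    have E := hd _ _ _ xd yd zd.
    have -> : h (pc_x c t) (pc_y c t) (z t) - (hx * pc_x c t + hy * pc_y c t) =
      h (pc_x c t) (pc_y c t) (z t) -
      (hx * pc_x c t + hy * pc_y c t + hz * z t) + hz * z t.
      by ring.
    apply: (le_trans (ler_normD _ _)); apply: lerD.
      by apply: (le_trans E); rewrite ler_pM2l //; move: xb yb zt Mr; arith.
    by rewrite normrM -mulrA ler_pM.
  have hf : `|fz| <= L by rewrite lerDl.
  have hg : `|gz| <= L by rewrite lerDr.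
  have Ef := step f fx fy fz d1 d10 rd1 hf fd.
  have Eg := step g gx gy gz d2 d20 rd2 hg gd.
  have -> : D t =
      (f (pc_x c t) (pc_y c t) (z t) - (fx * pc_x c t + fy * pc_y c t)) * pc_dx c t +
      (g (pc_x c t) (pc_y c t) (z t) - (gx * pc_x c t + gy * pc_y c t)) * pc_dy c t.
    by rewrite /D /lift_field; ring.
  apply: (le_trans (norm_mulD_le Ef Eg dxb dyb)).
  have -> : 2 * (e * (2 * m + M * r) + L * M * r ^+ 2) * m =
    80 * r ^+ 2 * (e * (80 + M) + r * (L * M)) by rewrite /m; ring.
  have -> : e * (80 + M) = k / (96 * 100) by rewrite /e; field; rewrite gt_eqF.
  have -> : k * r ^+ 2 / 60 = 80 * r ^+ 2 * (k / (48 * 100)) by field.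
  have r20 : 0 < 80 * r ^+ 2 by rewrite mulr_gt0 // exprn_gt0.
  by rewrite ler_pM2l //; move: rL k0 r0; arith.
have := MVT_le zQc zQd Db ler01.
rewrite !fctE /= subr0 mulr1 z0 -[(gx - fy) * s * r / 30]opprK -loop_primitive01.
by apply: le_trans; rewrite le_eqVlt; apply/orP; left; apply/eqP; congr Num.norm; ring.
Qed.

(** The final height, as a function of [s] in [-r, r], is Lipschitz by
    [lift_stability]; at the ends it is close to that of the loop based at the
    origin, whose sign is known. The intermediate value theorem applies as soon
    as [d] is small compared with r^2. *)
Lemma lift_connects e : 0 < e -> exists2 d : R, 0 < d &
  forall x0 y0 z0 x1 y1 z1, `|x0| <= d -> `|y0| <= d -> `|z0| <= d ->
    `|x1| <= d -> `|y1| <= d -> `|z1| <= d ->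
  exists r s z, let c := loop_curve x0 y0 (x1 - x0) (y1 - y0) r s in
  [/\ is_lift c z, z 0 = z0, z 1 = z1 &
      forall t, `|t| <= 2 -> [/\ `|pc_x c t| < e, `|pc_y c t| < e & `|z t| < e]].
Proof.
move=> e0; have [r1 r10 disp] := loop_displacement.
set k := `|gx - fy| in disp; have k0 : 0 < k by rewrite normr_gt0.
pose M := 16 * K * (40 * 40); have M0 : 0 <= M by rewrite !mulr_ge0.
have M50 : 0 < 50 + M by rewrite ltr_wpDr.
pose r := Num.min r1 (Num.min 1 (e / 2) / (50 + M)).
have r0 : 0 < r by rewrite lt_min r10 divr_gt0 // lt_min ltr01 divr_gt0.
have rr1 : r <= r1 by rewrite ge_min lexx.
have : r * (50 + M) <= Num.min 1 (e / 2).
  by rewrite -ler_pdivlMr // ge_min lexx orbT.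
rewrite le_min => /andP[rM1 rMe].
have rM0 : 0 <= r * M by rewrite mulr_ge0 // ltW.
have r1' : r <= 1 by move: rM1 rM0 r0; arith.
have Mrr : M * r ^+ 2 <= M * r by rewrite ler_wpM2l // expr2 ler_piMr // ltW.
have K3 : 0 < 3 + 720 * K by move: K0; arith.
(* By lift_stability, moving the points by d moves the final height by at most
   (2 + 720 K) d; one more d accounts for the target height z1. *)
pose d := Num.min (r / 2) (k * r ^+ 2 / 120 / (3 + 720 * K)).
have kr0 : 0 < k * r ^+ 2 by rewrite mulr_gt0 // exprn_gt0.
have d0 : 0 < d by rewrite lt_min !divr_gt0.
have dr : d <= r / 2 by rewrite ge_min lexx.
have dk : d * (3 + 720 * K) <= k * r ^+ 2 / 120.
  by rewrite -ler_pdivlMr // ge_min lexx orbT.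
exists d => // x0 y0 z0 x1 y1 z1 x0d y0d z0d x1d y1d z1d.
have Km : 16 * K * (40 * r) <= 1 by rewrite /M in rM1; move: rM1 r0; arith.
have x0r : `|x0| <= r by move: x0d dr r0; arith.
have y0r : `|y0| <= r by move: y0d dr r0; arith.
have dxd : `|x1 - x0| <= 2 * d.
  by apply: (le_trans (ler_normB _ _)); move: x0d x1d; arith.
have dyd : `|y1 - y0| <= 2 * d.
  by apply: (le_trans (ler_normB _ _)); move: y0d y1d; arith.
have dxr : `|x1 - x0| <= r by move: dxd dr; arith.
have dyr : `|y1 - y0| <= r by move: dyd dr; arith.
pose C s := loop_curve x0 y0 (x1 - x0) (y1 - y0) r (clamp r s).
have Cb s : pc_bounded (40 * r) (C s).
  by apply: loop_curve_bounded => //; apply: clamp_norm; exact: ltW.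
have /choice[Z ZP] : forall s, exists z, is_lift (C s) z /\ z 0 = z0.
  move=> s; apply: lift_exists (Cb s) Km; exact: loop_curve_continuous.
have Zb s t : `|t| <= 2 -> `|Z s t| <= 2 * `|z0| + M * r ^+ 2.
  move=> t2; have [zl zz] := ZP s.
  by have := lift_bound (Cb s) Km zl t2; rewrite zz /M; arith.
have Z1 s t : `|t| <= 2 -> `|Z s t| <= 1.
  by move=> /(Zb s)/le_trans; apply; move: z0d dr Mrr rM1 r0; arith.
have m1 : 40 * r <= 1 by move: rM1 rM0 r0; arith.
have t1 : `|1 : R| <= 2 by rewrite normr1 ler1n.
have n0 : `|0 : R| <= r by rewrite normr0 ltW.
have nd0 (x : R) : 0 <= x -> forall y, `|y - y| <= x.
  by move=> x0' y; rewrite subrr normr0.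
have Zlip s s' : `|Z s 1 - Z s' 1| <= 360 * K * `|s - s'|.
  have [zl zz] := ZP s; have [zl' zz'] := ZP s'.
  have close : pc_close (9 * `|s - s'|) (C s) (C s').
    by apply: loop_curve_close; do ?[exact: nd0]; exact: clamp_lip.
  have := lift_stability m1 Km (Cb s) (Cb s') close zl zl' (Z1 s') t1.
  by rewrite zz zz' subrr normr0; arith.
have Zc : continuous (fun s => Z s 1).
  move=> s; apply/cvgrPdist_le => u u0.
  have cv : 360 * K * `|s - s'| @[s' --> s] --> 360 * K * `|s - s|.
    apply: cvgM; first exact: cvg_cst.
    by apply: cvg_norm; apply: cvgB; [exact: cvg_cst|exact: cvg_id].
  rewrite subrr normr0 mulr0 in cv.
  near=> s'; apply: (le_trans (Zlip _ _)).
  by near: s'; apply: cvgr_le cv _ u0.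
have Zend s : `|s| = r -> `|Z s 1 + (gx - fy) * s * r / 30| < k * r ^+ 2 / 30 - `|z1|.
  move=> sr; have [zl zz] := ZP s.
  pose C0 := loop_curve 0 0 0 0 r s.
  have C0b : pc_bounded (40 * r) C0 by apply: loop_curve_bounded; rewrite ?sr.
  have [w [wl w0]] := lift_exists 0 (loop_curve_continuous 0 0 0 0 r s) C0b Km.
  have wb t : `|t| <= 2 -> `|w t| <= 1.
    move=> t2; have := lift_bound C0b Km wl t2; rewrite w0 normr0.
    by move/le_trans; apply; rewrite /M in Mrr rM1; move: Mrr rM1 r0; arith.
  have close : pc_close (9 * (2 * d)) (C s) C0.
    apply: loop_curve_close; rewrite ?subr0 //.
    - by move: x0d d0; arith.
    - by move: y0d d0; arith.
    - by rewrite clamp_id ?sr // subrr normr0; move: d0; arith.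
  have S := lift_stability m1 Km (Cb s) C0b close zl wl wb t1.
  rewrite zz w0 subr0 in S.
  have D := disp r r0 rr1 s sr w wl w0.
  have -> : Z s 1 + (gx - fy) * s * r / 30 =
    (Z s 1 - w 1) + (w 1 + (gx - fy) * s * r / 30) by ring.
  apply: (le_lt_trans (ler_normD _ _)); apply: (le_lt_trans (lerD S D)).
  have dK : 0 <= d * K by rewrite mulr_ge0 // ltW.
  move: dK dk z0d z1d d0 kr0; arith.
have rN : - r <= r by move: r0; arith.
have [| s /[!in_itv] /= sr Zs] :=
    @IVT R (fun s => Z s 1) (- r) r z1 rN (continuous_subspaceT Zc).
  have Er := Zend r (gtr0_norm r0).
  have ENr : `|Z (- r) 1 + (gx - fy) * (- r) * r / 30| < k * r ^+ 2 / 30 - `|z1|.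
    by apply: Zend; rewrite normrN gtr0_norm.
  have z1n := ler_norm z1; have z1n' := ler_norm (- z1); rewrite normrN in z1n'.
  move: Er ENr; rewrite !ltr_norml => /andP[e1 e2] /andP[e3 e4].
  rewrite ge_min le_max /k; case: (ltP 0 (gx - fy)) => cs.
    rewrite /k gtr0_norm // in e1 e2 e3 e4.
    by apply/andP; split; apply/orP; [right|left]; move: e1 e2 e3 e4 z1n z1n'; arith.
  have {}cs : gx - fy < 0 by rewrite lt_neqAle curl.
  rewrite /k ltr0_norm // in e1 e2 e3 e4.
  by apply/andP; split; apply/orP; [left|right]; move: e1 e2 e3 e4 z1n z1n'; arith.
have [zl zz] := ZP s.
exists r, (clamp r s), (Z s); split => // t t2.
have [xb yb _ _] := Cb s t t2.
have re : 40 * r < e by move: rMe rM0 r0; arith.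
split; [exact: le_lt_trans re|exact: le_lt_trans re|].
by apply: (le_lt_trans (Zb s t t2)); move: z0d dr Mrr rMe r0 rM0; arith.
Unshelve. all: by end_near. Qed.

End horizontal_lift.

(** * Frames adapted to a contact form *)

Section contact_forms.
Context {R : realType}.
Implicit Types (alpha : 'rV[R]_3 -> 'cV[R]_3) (u v w p : 'rV[R]_3).

Lemma form_evalD alpha u v p :
  form_eval alpha (u + v) p = form_eval alpha u p + form_eval alpha v p.
Proof. by rewrite /form_eval mulmxDl mxE. Qed.

Lemma form_evalZ alpha a u p : form_eval alpha (a *: u) p = a * form_eval alpha u p.
Proof. by rewrite /form_eval -scalemxAl mxE. Qed.

Lemma form_evalE alpha u p : form_eval alpha u p = \sum_j u 0 j * alpha p j 0.
Proof. by rewrite /form_eval mxE. Qed.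

Lemma Ck_on_form_eval k (A : set 'rV[R]_3) alpha u : open A ->
  Ck_on k A alpha -> Ck_on k A (form_eval alpha u).
Proof.
move=> oA aC.
have := Ck_on_sum oA
  (fun j => Ck_onM oA (Ck_on_cst k A (u 0 j)) (Ck_on_mx_entry j 0 oA aC)).
by apply: Ck_on_ext => // x _; rewrite form_evalE.
Qed.

Lemma derive_form_eval alpha u v p : differentiable alpha p ->
  'D_v (form_eval alpha u) p = \sum_j u 0 j * 'd alpha p v j 0.
Proof.
move=> da.
pose h j : 'rV[R]_3 -> R := fun x => alpha x j 0.
have dh j : differentiable (h j) p.
  apply: (@differentiable_comp _ _ _ _ alpha (fun M : 'cV[R]_3 => M j 0)) => //.
  exact: differentiable_coord.
have -> : form_eval alpha u = \sum_j (u 0 j \*: h j).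
  by apply/funext => x; rewrite form_evalE fct_sumE.
rewrite derive_sum; last by move=> j; apply: derivableZ; exact: diff_derivable.
apply: eq_bigr => j _; rewrite deriveZ; last exact: diff_derivable.
by rewrite -(deriveE _ da) derive_mx ?mxE //; exact: diff_derivable.
Qed.

Lemma derive_form_eval_lin1 alpha u v v' a p : differentiable alpha p ->
  'D_(v + a *: v') (form_eval alpha u) p =
  'D_v (form_eval alpha u) p + a * 'D_v' (form_eval alpha u) p.
Proof.
move=> da; rewrite !derive_form_eval // mulr_sumr -big_split; apply: eq_bigr => j _.
by rewrite linearD linearZ !mxE /=; ring.
Qed.

Lemma derive_form_eval_lin2 alpha u u' v a p : differentiable alpha p ->
  'D_v (form_eval alpha (u + a *: u')) p =
  'D_v (form_eval alpha u) p + a * 'D_v (form_eval alpha u') p.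
Proof.
move=> da; rewrite !derive_form_eval // mulr_sumr -big_split; apply: eq_bigr => j _.
by rewrite !mxE /=; ring.
Qed.

(** Replacing u and v by u - (alpha(u) / alpha(w)) w and v - (alpha(v) / alpha(w)) w
    does not change (alpha /\ dalpha)(u, v, w), which becomes
    alpha(w) dalpha(u, v). One of u, v, w has a nonzero image under alpha, and a
    cyclic rotation makes it w. *)
Lemma contact_frame alpha p : differentiable alpha p ->
  (exists u v w, wedge_dform alpha u v w p != 0) ->
  exists e1 e2 e3, [/\ form_eval alpha e1 p = 0, form_eval alpha e2 p = 0,
    form_eval alpha e3 p != 0 & dform alpha e1 e2 p != 0].
Proof.
move=> da.
have key u v w : form_eval alpha w p != 0 -> wedge_dform alpha u v w p != 0 ->
    exists e1 e2 e3, [/\ form_eval alpha e1 p = 0, form_eval alpha e2 p = 0,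
      form_eval alpha e3 p != 0 & dform alpha e1 e2 p != 0].
  move=> w0; set a := form_eval alpha u p / form_eval alpha w p.
  set b := form_eval alpha v p / form_eval alpha w p => W0.
  exists (u + (- a) *: w), (v + (- b) *: w), w.
  rewrite !form_evalD !form_evalZ; split=> //.
  - by rewrite /a; field.
  - by rewrite /b; field.
  - apply: contra W0 => /eqP d0; apply/eqP.
    rewrite -[RHS](mulr0 (form_eval alpha w p)) -d0 /wedge_dform /dform.
    rewrite !(derive_form_eval_lin1, derive_form_eval_lin2) // /a /b.
    pose T x y := 'D_x (form_eval alpha y) p.
    rewrite -!/(T _ _); move: (T) => S; move: w0.
    move: (form_eval alpha u p) (form_eval alpha v p) (form_eval alpha w p) => x y z z0.
    move: (S u v) (S u w) (S v u) (S v w) (S w u) (S w v) (S w w) => *; by field.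
have wedge_rot u v w : wedge_dform alpha u v w p = wedge_dform alpha v w u p.
  by rewrite /wedge_dform; ring.
move=> [u [v [w W0]]].
have [w0|w0] := eqVneq (form_eval alpha w p) 0; last exact: key w0 W0.
have [v0|v0] := eqVneq (form_eval alpha v p) 0; last first.
  by apply: (key w u v v0); rewrite wedge_rot.
have [u0|u0] := eqVneq (form_eval alpha u p) 0; last first.
  by apply: (key v w u u0); rewrite -wedge_rot.
by move: W0; rewrite /wedge_dform u0 v0 w0 !mul0r !addr0 eqxx.
Qed.


(** A linear relation between the [e i] is killed by applying first alpha, then
    dalpha against [e 0] and [e 1]. *)
Lemma frame_unitmx alpha p (e : 'I_3 -> 'rV[R]_3) : differentiable alpha p ->
  form_eval alpha (e 0) p = 0 -> form_eval alpha (e 1) p = 0 ->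
  form_eval alpha (e 2) p != 0 -> dform alpha (e 0) (e 1) p != 0 ->
  \matrix_i e i \in unitmx.
Proof.
move=> da a0 a1 a2 d01; rewrite -row_free_unit; apply: inj_row_free => k.
rewrite mulmx_sum_row !big_ord_recl big_ord0 addr0 !rowK.
set i1 : 'I_3 := lift _ _; set i2 : 'I_3 := lift _ _.
have -> : i1 = 1 by exact: val_inj.
have -> : i2 = 2 by exact: val_inj.
move=> kE.
have k2 : k 0 2 = 0.
  have := congr1 (form_eval alpha ^~ p) kE.
  rewrite !form_evalD !form_evalZ a0 a1 !mulr0 !add0r {2}/form_eval mul0mx mxE.
  by move/eqP; rewrite mulf_eq0 (negbTE a2) orbF => /eqP.
rewrite k2 scale0r addr0 in kE.
have dD x y a b : dform alpha (a *: e 0 + b *: e 1) (x *: e 0 + y *: e 1) p =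
    (a * y - b * x) * dform alpha (e 0) (e 1) p.
  rewrite /dform -[a *: e 0]add0r -[x *: e 0]add0r.
  rewrite !(derive_form_eval_lin1, derive_form_eval_lin2) //.
  have D0 u : 'D_u (form_eval alpha 0) p = 0.
    by rewrite derive_form_eval // big1 // => j _; rewrite mxE mul0r.
  by rewrite !D0 !derive0; ring.
have d00 x : dform alpha 0 x p = 0.
  by rewrite /dform derive0 derive_form_eval // big1 ?subrr // => j _; rewrite mxE mul0r.
have k0 : k 0 0 = 0.
  have := dD 0 1 (k 0 0) (k 0 1); rewrite kE d00 mulr1 mulr0 subr0 => /esym/eqP.
  by rewrite mulf_eq0 (negbTE d01) orbF => /eqP.
have k1 : k 0 1 = 0.
  have := dD 1 0 (k 0 0) (k 0 1); rewrite kE d00 mulr1 mulr0 sub0r => /esym/eqP.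
  by rewrite mulf_eq0 (negbTE d01) orbF oppr_eq0 => /eqP.
apply/rowP => j; rewrite mxE; case: j => [[|[|[|//]]] Hj].
- by rewrite -[RHS]k0; congr (k _ _); exact: val_inj.
- by rewrite -[RHS]k1; congr (k _ _); exact: val_inj.
- by rewrite -[RHS]k2; congr (k _ _); exact: val_inj.
Qed.

End contact_forms.

(** * Affine coordinates in a frame *)

Section affine_coordinates.
Context {R : realType} {V : normedModType R}.
Implicit Types (p : V) (e : 'I_3 -> V).

(** The base point enters as a fourth vector with coefficient 1, which makes
    affine coordinates an instance of the linear combinations handled by the
    chain rule. *)
Definition affine_base p e (j : 'I_4) : V := nth 0 [:: p; e 0; e 1; e 2] j.
Definition affine_coef (x y z : R) (j : 'I_4) : R := nth 0 [:: 1; x; y; z] j.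
Definition affine_pt p e x y z : V := \sum_j affine_coef x y z j *: affine_base p e j.

Lemma affine_ptE p e x y z : affine_pt p e x y z = p + (x *: e 0 + y *: e 1 + z *: e 2).
Proof.
rewrite /affine_pt !big_ord_recl big_ord0 /affine_coef /affine_base /= scale1r addr0.
by rewrite !addrA.
Qed.

Lemma affine_pt_nbhs p e (S : set V) : nbhs p S -> exists2 r : R, 0 < r &
  forall x y z, `|x| <= r -> `|y| <= r -> `|z| <= r -> S (affine_pt p e x y z).
Proof.
move=> /nbhs_ballP[d /= d0 dS].
pose N := `|e 0| + `|e 1| + `|e 2| + 1.
have N0 : 0 < N by rewrite ltr_wpDl // !addr_ge0.
exists (d / 2 / N); first by rewrite !divr_gt0.
move=> x y z xr yr zr; apply: dS; rewrite -ball_normE /ball_ /= affine_ptE.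
rewrite opprD addNKr normrN.
apply: (@le_lt_trans _ _ (d / 2)); last by rewrite ltr_pdivrMr // ltr_pMr // ltr1n.
apply: (@le_trans _ _ (d / 2 / N * (`|e 0| + `|e 1| + `|e 2|))).
  rewrite !mulrDr; apply: (le_trans (ler_normD _ _)); apply: lerD; last first.
    by rewrite normrZ ler_wpM2r.
  by apply: (le_trans (ler_normD _ _)); apply: lerD; rewrite normrZ ler_wpM2r.
rewrite -[leRHS](divfK (lt0r_neq0 N0)) ler_wpM2l ?divr_ge0 ?(ltW d0) ?(ltW N0) //.
by rewrite lerDl.
Qed.

(** Mean value theorem along the segment between the two clamped triples, which
    stays in the cube where the partial derivatives are bounded. *)
Lemma affine_clamped_lip (fr : V -> R) p e (r K : R) : 0 <= r ->
  (forall x y z, `|x| <= r -> `|y| <= r -> `|z| <= r ->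
    differentiable fr (affine_pt p e x y z) /\
    forall j, `|'D_(e j) fr (affine_pt p e x y z)| <= K) ->
  lipschitz3 K (fun x y z =>
    fr (affine_pt p e (clamp r x) (clamp r y) (clamp r z))).
Proof.
move=> r0 frK x y z x' y' z'.
have K0 : 0 <= K.
  have [] := frK 0 0 0; rewrite ?normr0 // => _ /(_ 0); exact: le_trans.
suff key a b c a' b' c' : `|a| <= r -> `|b| <= r -> `|c| <= r ->
    `|a'| <= r -> `|b'| <= r -> `|c'| <= r ->
  `|fr (affine_pt p e a b c) - fr (affine_pt p e a' b' c')| <=
  K * (`|a - a'| + `|b - b'| + `|c - c'|).
  apply: (le_trans (key _ _ _ _ _ _ _ _ _ _ _ _)); rewrite ?clamp_norm //.
  by rewrite ler_wpM2l // !lerD // clamp_lip.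
move=> ar br cr ar' br' cr'.
pose l u u' (t : R) := u' + t * (u - u').
have dl u u' (t : R) : is_derive t 1 (l u u') (u - u').
  by apply: is_derive_eq; rewrite /GRing.scale /=; ring.
have lr u u' t : 0 <= t <= 1 -> `|u| <= r -> `|u'| <= r -> `|l u u' t| <= r.
  move=> /andP[t0 t1]; rewrite !ler_norml => /andP[? ?] /andP[? ?].
  by apply/andP; split; rewrite /l; nra.
pose cf (j : 'I_4) t := affine_coef (l a a' t) (l b b' t) (l c c' t) j.
pose dcf (j : 'I_4) : R := nth 0 [:: 0; a - a'; b - b'; c - c'] j.
have dc j (t : R) : is_derive t 1 (cf j) (dcf j).
  by case: j => [[|[|[|[|//]]]] Hj]; [exact: is_derive_cst|exact: dl|exact: dl|exact: dl].
pose h t := fr (\sum_j cf j t *: affine_base p e j).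
have hE t : h t = fr (affine_pt p e (l a a' t) (l b b' t) (l c c' t)) by [].
pose P t := \sum_j cf j t *: affine_base p e j.
pose dh t := (a - a') * 'D_(e 0) fr (P t) + (b - b') * 'D_(e 1) fr (P t)
  + (c - c') * 'D_(e 2) fr (P t).
have frP t : 0 <= t <= 1 ->
    differentiable fr (P t) /\ forall j, `|'D_(e j) fr (P t)| <= K.
  by move=> t01; apply: frK; exact: lr.
have hd (t : R) : 0 <= t <= 1 -> is_derive t 1 h (dh t).
  move=> t01; have [dfr _] := frP t t01.
  have dcj j : differentiable (cf j) t by apply/derivable1_diffP; have [] := dc j t.
  have dP : differentiable P t by exact: differentiable_lincomb.
  apply: DeriveDef.
    apply: diff_derivable; exact: (@differentiable_comp _ _ _ _ P fr).
  rewrite /h derive_comp_lincomb // -/(P t) !big_ord_recl big_ord0 addr0.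
  rewrite !(@derive_val _ _ _ _ _ _ _ (dc _ t)) /dcf /affine_base /=.
  by rewrite scale0r add0r addrA.
have hc : {within `[0, 1], continuous h}.
  by apply: derivable_within_continuous => t; rewrite in_itv /= => /hd[].
have [t|t] := @MVT R h dh 0 1 ltr01 _ hc.
  by rewrite in_itv /= => /andP[t0 t1]; apply: hd; rewrite !ltW.
rewrite in_itv /= => /andP[t0 t1].
have l0 u u' : l u u' 0 = u' by rewrite /l mul0r addr0.
have l1 u u' : l u u' 1 = u by rewrite /l mul1r addrC subrK.
rewrite !hE !l0 !l1 subr0 mulr1 => ->.
have [|_ DK] := frP t; first by rewrite !ltW.
rewrite /dh [leRHS]mulrC [leRHS]mulrDl [X in _ <= X + _]mulrDl.
apply: (le_trans (ler_normD _ _)); apply: lerD; last by rewrite normrM ler_wpM2l.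
by apply: (le_trans (ler_normD _ _)); apply: lerD; rewrite normrM ler_wpM2l.
Qed.

Lemma affine_diff_expansion (fr : V -> R) p e : differentiable fr p -> fr p = 0 ->
  linearized0 (fun x y z => fr (affine_pt p e x y z))
    ('D_(e 0) fr p) ('D_(e 1) fr p) ('D_(e 2) fr p).
Proof.
move=> df f0 eps eps0.
pose N := `|e 0| + `|e 1| + `|e 2| + 1.
have N0 : 0 < N by rewrite ltr_wpDl // !addr_ge0.
have /eqaddoP /(_ _ (divr_gt0 eps0 N0)) := diff_locally df.
move=> /(affine_pt_nbhs e)[d d0 dE]; exists d => // x y z xd yd zd.
have := dE x y z xd yd zd; rewrite !affine_ptE add0r; set v := x *: _ + _ + _.
rewrite /= !fctE /= f0 add0r [v + p]addrC.
have -> : 'd fr p v = 'D_(e 0) fr p * x + 'D_(e 1) fr p * y + 'D_(e 2) fr p * z.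
  by rewrite !deriveE // /v !linearD !linearZ /= /GRing.scale /=; ring.
move/le_trans; apply; rewrite -mulrA ler_pM2l // ler_pdivrMl //.
have e_le j : `|e j| <= N.
  rewrite /N; case: j => [[|[|[|//]]] Hj].
  - rewrite (_ : Ordinal Hj = 0); last exact: val_inj.
    by rewrite -!addrA lerDl !addr_ge0.
  - rewrite (_ : Ordinal Hj = 1); last exact: val_inj.
    by rewrite addrAC [`|e 0| + _]addrC -!addrA lerDl !addr_ge0.
  - rewrite (_ : Ordinal Hj = 2); last exact: val_inj.
    by rewrite addrAC lerDr !addr_ge0.
rewrite !mulrDr; apply: (le_trans (ler_normD _ _)); apply: lerD; last first.
  by rewrite normrZ mulrC ler_wpM2r.
by apply: (le_trans (ler_normD _ _)); apply: lerD; rewrite normrZ mulrC ler_wpM2r.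
Qed.

End affine_coordinates.

Lemma affine_pt_coords (R : realType) (p : 'rV[R]_3) (e : 'I_3 -> 'rV[R]_3) (d : R) :
  \matrix_i e i \in unitmx -> 0 < d ->
  nbhs p [set q | exists x y z, [/\ `|x| <= d, `|y| <= d, `|z| <= d &
                                   q = affine_pt p e x y z]].
Proof.
move=> Eu d0; set E := \matrix_i e i in Eu.
pose c j (q : 'rV[R]_3) := ((q - p) *m invmx E) 0 j.
have cc j : continuous (c j).
  move=> q.
  have : Ck_on 0 [set: 'rV[R]_3]
      (fun q : 'rV[R]_3 => \sum_k (q 0 k - p 0 k) * invmx E k j).
    apply: (Ck_on_sum openT) => k; apply: (Ck_onM openT); last exact: Ck_on_cst.
    apply: (Ck_onB openT); last exact: Ck_on_cst.
    by apply: (Ck_on_mx_entry _ _ openT); exact: Ck_on_id.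
  have -> : (fun q : 'rV[R]_3 => \sum_k (q 0 k - p 0 k) * invmx E k j) =
      c j :> ('rV[R]_3 -> R).
    by apply/funext => u; rewrite /c mxE; apply: eq_bigr => k _; rewrite !mxE.
  exact.
have cd j : \forall q \near p, `|c j q| <= d.
  have cp : c j p = 0 by rewrite /c subrr mul0mx mxE.
  have : c j x @[x --> p] --> (0 : R) by rewrite -cp; exact: cc.
  by move=> /cvgr0Pnorm_le; exact.
near=> q; exists (c 0 q), (c 1 q), (c 2 q); split; [near: q; exact: cd ..|].
rewrite affine_ptE.
have -> : c 0 q *: e 0 + c 1 q *: e 1 + c 2 q *: e 2 = (q - p) *m invmx E *m E.
  rewrite [RHS]mulmx_sum_row !big_ord_recl big_ord0 addr0 !rowK addrA /c.
  by congr (_ + _ *: e _ + _ *: e _); do ?congr (fun_of_matrix _ _ _); exact: val_inj.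
by rewrite mulmxKV // addrC subrK.
Unshelve. all: by end_near. Qed.

(** * Joining nearby points by horizontal arcs in a chart *)

Section horizontal_arcs.
Context {R : realType}.

Lemma open_ball0 (r : R) : open [set t : R | `|t| < r].
Proof.
rewrite (_ : mkset _ = ball (0 : R) r); first exact: ball_open.
by apply/seteqP; split=> t; rewrite -ball_normE /ball_ /= sub0r normrN.
Qed.

Lemma derive_opp_quotient0 (V : normedModType R) (n d : V -> R) p v :
  differentiable n p -> differentiable d p -> n p = 0 -> d p != 0 ->
  'D_v (fun c => - (n c * (d c)^-1)) p = - ('D_v n p / d p).
Proof.
move=> dn dd n0 d0.
have dnv : derivable n p v by exact: diff_derivable.
have dV : derivable (fun c => (d c)^-1) p v.
  by apply: (derivableV d0); exact: diff_derivable.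
have dM : derivable (n * (fun c => (d c)^-1)) p v by exact: (derivableM dnv dV).
rewrite -[fun c => - _]/(- (n * (fun c => (d c)^-1))) (deriveN dM) (deriveM dnv dV).
by rewrite n0 scale0r add0r /GRing.scale /= mulrC.
Qed.

(** Regularity of the lift is bootstrapped: if z is of class C^k then so is the
    right-hand side of its equation. *)
Lemma smooth_lift (f g : 'rV[R]_3 -> R) (S : set 'rV[R]_3) p (e : 'I_3 -> 'rV[R]_3)
    (x y dx dy z : R -> R) :
  smooth_on S f -> smooth_on S g ->
  smooth_on setT x -> smooth_on setT y -> smooth_on setT dx -> smooth_on setT dy ->
  (forall t, `|t| < 2 -> S (affine_pt p e (x t) (y t) (z t))) ->
  (forall t : R, `|t| < 2 -> is_derive t 1 z
     (f (affine_pt p e (x t) (y t) (z t)) * dx t +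
      g (affine_pt p e (x t) (y t) (z t)) * dy t)) ->
  smooth_on [set t : R | `|t| < 2] z.
Proof.
move=> fS gS xS yS dxS dyS Sz dz; have oI := @open_ball0 2.
have TI (h : R -> R) k : smooth_on setT h -> Ck_on k [set t : R | `|t| < 2] h.
  by move=> hS; apply: Ck_onS (hS k).
elim=> [t t2|k IH].
  by apply: differentiable_continuous; apply/derivable1_diffP; have [] := dz t t2.
apply: (Ck_on_primitive oI dz).
have comp (h : 'rV[R]_3 -> R) : smooth_on S h ->
    Ck_on k [set t : R | `|t| < 2] (fun t => h (affine_pt p e (x t) (y t) (z t))).
  move=> hS.
  apply: (@Ck_on_comp_lincomb R R 'rV[R]_3 R k 4 (affine_base p e)
    (fun j t => affine_coef (x t) (y t) (z t) j) h _ S oI _ Sz (hS k)) => j.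
  case: j => [[|[|[|[|//]]]] Hj]; rewrite /affine_coef /=.
  - exact: Ck_on_cst.
  - exact: TI.
  - exact: TI.
  - exact: IH.
by apply: (Ck_onD oI); apply: (Ck_onM oI); do ?[exact: comp|exact: TI].
Qed.

(** The local form of Chow's theorem. The functions [f] and [g] of the lifting
    problem are only defined near [p]; they are made global by clamping the
    coordinates to a cube, and the clamping is inactive along the arcs found. *)
Lemma horizontal_arcs (alpha : 'rV[R]_3 -> 'cV[R]_3) (A : set 'rV[R]_3) p :
  open A -> A p -> smooth_on A alpha ->
  (exists u v w, wedge_dform alpha u v w p != 0) ->
  exists2 W, nbhs p W & forall q q', W q -> W q' -> exists c : R -> 'rV[R]_3,
    [/\ smooth_on [set t : R | `|t| < 2] c, c 0 = q, c 1 = q' &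
        forall t : R, `|t| < 2 -> A (c t) /\ form_eval alpha ('D_1 c t) (c t) = 0].
Proof.
move=> oA Ap aS wedge.
have da : differentiable alpha p by exact: (aS 1%N).1.
have [e1 [e2 [e3 [a1 a2 a3 d12]]]] := contact_frame da wedge.
pose e (j : 'I_3) := nth 0 [:: e1; e2; e3] j.
pose num (j : 'I_3) c := form_eval alpha (e j) c.
have numS j k : Ck_on k A (num j) by exact: Ck_on_form_eval.
pose S := A `&` [set c | num 2 c != 0].
have Sn c : S c -> nbhs c S.
  move=> [Ac n0]; apply: filterI; first exact: open_nbhs_nbhs.
  have : num 2 x @[x --> c] --> num 2 c by exact: (numS 2 0%N).
  by move/cvgr_neq0; apply.
have oS : open S by rewrite openE.
have Sp : S p by split.
pose fr j c := - (num j c * (num 2 c)^-1).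
have frS j : smooth_on S (fr j).
  move=> k; apply: (Ck_onN oS); apply: (Ck_onM oS).
    by apply: Ck_onS (numS j k) => c [].
  by apply: (Ck_on_inv oS) => [c []//|]; apply: Ck_onS (numS 2 k) => c [].
have dnum j : differentiable (num j) p by exact: (numS j 1%N).1.
have Dfr j v : num j p = 0 -> 'D_v (fr j) p = - ('D_v (num j) p / num 2 p).
  by move=> nj0; exact: derive_opp_quotient0.
pose K := \sum_i \sum_j `|'D_(e j) (fr i) p| + 1.
have Kle i j : `|'D_(e j) (fr i) p| < K.
  rewrite /K (bigD1 i) //= (bigD1 j) //= -!addrA ltrDl.
  by rewrite addrA ltr_wpDl // addr_ge0 ?sumr_ge0 // => k _; rewrite sumr_ge0.
have K0 : 0 <= K by apply: le_trans (ltW (Kle 0 0)).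
have near_p : \forall c \near p, S c /\ forall i j, `|'D_(e j) (fr i) c| <= K.
  suff : \forall c \near p, forall i j, `|'D_(e j) (fr i) c| <= K.
    by apply: filterS2 (Sn p Sp) => c.
  refine (@filter_forall _ _
    (fun i c => forall j, `|'D_(e j) (fr i) c| <= K) (nbhs p) _ _) => i.
  refine (@filter_forall _ _
    (fun j c => `|'D_(e j) (fr i) c| <= K) (nbhs p) _ _) => j.
  have : 'D_(e j) (fr i) x @[x --> p] --> 'D_(e j) (fr i) p.
    exact: ((frS i 1%N).2 (e j) p Sp).
  by move=> /cvg_norm /cvgr_le; apply; exact: Kle.
have [r r0 rP] := affine_pt_nbhs e near_p.
pose F i x y z := fr i (affine_pt p e (clamp r x) (clamp r y) (clamp r z)).
have c0 : clamp r 0 = 0 by rewrite clamp_id // normr0 ltW.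
have pt0 : affine_pt p e 0 0 0 = p by rewrite affine_ptE !scale0r !addr0.
have fr0 : fr 0 p = 0 by rewrite /fr /num a1 mul0r oppr0.
have fr1 : fr 1 p = 0 by rewrite /fr /num a2 mul0r oppr0.
have F0 i : fr i p = 0 -> F i 0 0 0 = 0 by rewrite /F c0 pt0.
have Flip i : lipschitz3 K (F i).
  apply: affine_clamped_lip (ltW r0) _ => x y z xr yr zr.
  have [Sc Kc] := rP x y z xr yr zr; split; last by move=> j; exact: Kc.
  exact: (frS i 1%N).1.
have Fdiff i : fr i p = 0 ->
    linearized0 (F i) ('D_(e 0) (fr i) p) ('D_(e 1) (fr i) p) ('D_(e 2) (fr i) p).
  move=> fi0 eps eps0.
  have dfr : differentiable (fr i) p by exact: (frS i 1%N).1.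
  have [d d0 dP] := affine_diff_expansion e dfr fi0 eps0.
  exists (Num.min d r); first by rewrite lt_min d0.
  move=> x y z; rewrite !le_min => /andP[? ?] /andP[? ?] /andP[? ?].
  by rewrite /F !clamp_id //; exact: dP.
have curl : 'D_(e 0) (fr 1) p - 'D_(e 1) (fr 0) p != 0.
  rewrite (Dfr 0) // (Dfr 1) // opprK addrC -mulrBl mulf_neq0 ?invr_eq0 //.
  by apply: contra d12; rewrite /dform subr_eq0 eq_sym subr_eq0.
have [d d0 conn] := lift_connects K0 (Flip 0) (Flip 1) (F0 0 fr0) (F0 1 fr1)
  (Fdiff 0 fr0) (Fdiff 1 fr1) curl r0.
have Eu : \matrix_i e i \in unitmx by exact: (frame_unitmx da a1 a2 a3 d12).
exists [set q | exists x y z, [/\ `|x| <= d, `|y| <= d, `|z| <= d &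
                                   q = affine_pt p e x y z]].
  exact: affine_pt_coords.
move=> _ _ [x0 [y0 [z0 [x0d y0d z0d ->]]]] [x1 [y1 [z1 [x1d y1d z1d ->]]]].
have [rr [s [z]]] := conn _ _ _ _ _ _ x0d y0d z0d x1d y1d z1d.
set cc := loop_curve _ _ _ _ _ _; move=> /= [[zc dz] zz0 zz1 bd].
have [xS yS dxS dyS] := loop_curve_smooth x0 y0 (x1 - x0) (y1 - y0) rr s.
have FE i t : `|t| < 2 -> F i (pc_x cc t) (pc_y cc t) (z t) =
    fr i (affine_pt p e (pc_x cc t) (pc_y cc t) (z t)).
  by move=> /ltW/bd[? ? ?]; rewrite /F !clamp_id // ltW.
have ptS t : `|t| < 2 -> S (affine_pt p e (pc_x cc t) (pc_y cc t) (z t)).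
  by move=> /ltW/bd[? ? ?]; have [] := rP (pc_x cc t) (pc_y cc t) (z t); rewrite ?ltW.
have dz' (t : R) : `|t| < 2 -> is_derive t 1 z
     (fr 0 (affine_pt p e (pc_x cc t) (pc_y cc t) (z t)) * pc_dx cc t +
      fr 1 (affine_pt p e (pc_x cc t) (pc_y cc t) (z t)) * pc_dy cc t).
  by move=> t2; rewrite -!FE //; exact: dz.
have zS := smooth_lift (frS 0) (frS 1) xS yS dxS dyS ptS dz'.
have oI := @open_ball0 2.
pose cf (j : 'I_4) t := affine_coef (pc_x cc t) (pc_y cc t) (z t) j.
have cfS j k : Ck_on k [set t : R | `|t| < 2] (cf j).
  case: j => [[|[|[|[|//]]]] Hj].
  - exact: Ck_on_cst.
  - by apply: Ck_onS (xS k).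
  - by apply: Ck_onS (yS k).
  - exact: zS.
exists (fun t => affine_pt p e (pc_x cc t) (pc_y cc t) (z t)); split.
- by move=> k; apply: (Ck_on_lincomb _ oI) => j; exact: cfS.
- by rewrite /cc /= zz0; congr affine_pt; ring.
- by rewrite /cc /= zz1; congr affine_pt; ring.
move=> t t2; have [Ac n2] := ptS t t2; split=> //.
set P := affine_pt p e (pc_x cc t) (pc_y cc t) (z t) in Ac n2 *.
have -> : 'D_1 (fun t => affine_pt p e (pc_x cc t) (pc_y cc t) (z t)) t =
    pc_dx cc t *: e 0 + pc_dy cc t *: e 1 +
    (fr 0 P * pc_dx cc t + fr 1 P * pc_dy cc t) *: e 2.
  rewrite [LHS](@derive_lincomb _ _ _ _ (affine_base p e) cf); last first.
    by move=> j; exact: (cfS j 1%N).1.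
  have [dxd dyd] := is_derive_loop x0 y0 (x1 - x0) (y1 - y0) rr s t.
  rewrite !big_ord_recl big_ord0 addr0 /affine_base /=.
  have -> : 'D_1 (cf ord0) t = 0 by exact: derive_cst.
  have -> : 'D_1 (cf (lift ord0 ord0)) t = pc_dx cc t by have [_] := dxd.
  have -> : 'D_1 (cf (lift ord0 (lift ord0 ord0))) t = pc_dy cc t by have [_] := dyd.
  have -> : 'D_1 (cf (lift ord0 (lift ord0 (lift ord0 ord0)))) t =
     fr 0 P * pc_dx cc t + fr 1 P * pc_dy cc t by have [_] := dz' t t2.
  by rewrite scale0r add0r addrA.
rewrite !form_evalD !form_evalZ -/(num 0 P) -/(num 1 P) -/(num 2 P) /fr.
by field.
Qed.

End horizontal_arcs.

(** * Short Legendrian arcs in a contact manifold *)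

Section frame_annihilator.
Context {R : realType}.

(** Indices are taken modulo 3. *)
Definition cross3 (F : 'M[R]_(2, 3)) : 'cV[R]_3 :=
  \col_j (F 0 (j + 1) * F 1 (j + 2) - F 0 (j + 2) * F 1 (j + 1)).

Lemma sum3 (h : 'I_3 -> R) : \sum_j h j = h 0 + h 1 + h 2.
Proof.
rewrite !big_ord_recl big_ord0 addr0 addrA.
by congr (_ + h _ + h _); exact: val_inj.
Qed.

Lemma ord3E : ((0 : 'I_3) + 1 = 1) * ((0 : 'I_3) + 2 = 2) * ((1 : 'I_3) + 1 = 2) *
  ((1 : 'I_3) + 2 = 0) * ((2 : 'I_3) + 1 = 0) * ((2 : 'I_3) + 2 = 1).
Proof. by do ![split]; exact: val_inj. Qed.

Lemma mul_cross3 (F : 'M[R]_(2, 3)) : F *m cross3 F = 0.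
Proof.
apply/matrixP => i j; rewrite mxE sum3 !mxE !ord3E.
case: i => [[|[|//]] Hi].
- by rewrite (_ : Ordinal Hi = 0); [ring|exact: val_inj].
- by rewrite (_ : Ordinal Hi = 1); [ring|exact: val_inj].
Qed.

Lemma cross3_neq0 (F : 'M[R]_(2, 3)) : row_free F -> cross3 F != 0.
Proof.
move=> /row_freeP[B FB]; apply/eqP => F0.
have m j : F 0 (j + 1) * F 1 (j + 2) - F 0 (j + 2) * F 1 (j + 1) = 0.
  by have := congr1 (fun C : 'cV[R]_3 => C j 0) F0; rewrite !mxE.
have := m 0; have := m 1; have := m 2; rewrite !ord3E => m2 m1 m0.
have e i j : \sum_k F i k * B k j = (i == j)%:R.
  by have := congr1 (fun C : 'M[R]_2 => C i j) FB; rewrite !mxE.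
have := e 0 0; have := e 0 1; have := e 1 0; have := e 1 1; rewrite !sum3 /=.
move=> e11 e10 e01 e00.
suff : (1 : R) = 0 by move/eqP; rewrite oner_eq0.
transitivity ((F 0 0 * B 0 0 + F 0 1 * B 1 0 + F 0 2 * B 2 0) *
  (F 1 0 * B 0 1 + F 1 1 * B 1 1 + F 1 2 * B 2 1) -
  (F 0 0 * B 0 1 + F 0 1 * B 1 1 + F 0 2 * B 2 1) *
  (F 1 0 * B 0 0 + F 1 1 * B 1 0 + F 1 2 * B 2 0)).
  by rewrite e00 e11 e01 e10; ring.
transitivity ((F 0 1 * F 1 2 - F 0 2 * F 1 1) * (B 1 0 * B 2 1 - B 2 0 * B 1 1) +
  (F 0 2 * F 1 0 - F 0 0 * F 1 2) * (B 2 0 * B 0 1 - B 0 0 * B 2 1) +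
  (F 0 0 * F 1 1 - F 0 1 * F 1 0) * (B 0 0 * B 1 1 - B 1 0 * B 0 1)); first by ring.
by rewrite m0 m1 m2 !mul0r !addr0.
Qed.

(** The row space of [F] is contained in the annihilator of the cross product of
    its rows, and both have dimension 2. *)
Lemma sub_cross3 (F : 'M[R]_(2, 3)) (v : 'rV[R]_3) : row_free F ->
  (v <= F)%MS <-> (v *m cross3 F) 0 0 = 0.
Proof.
move=> Ff; have sub : (F <= kermx (cross3 F))%MS by apply/sub_kermxP; exact: mul_cross3.
have rk : \rank F = \rank (kermx (cross3 F)).
  rewrite mxrank_ker (eqP Ff); suff -> : \rank (cross3 F) = 1%N by [].
  apply/eqP; rewrite eqn_leq rank_leq_col lt0n mxrank_eq0; exact: cross3_neq0.
have sup : (kermx (cross3 F) <= F)%MS by rewrite -(geq_leqif (mxrank_leqif_sup sub)) rk.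
split=> [vF|v0]; first by rewrite (sub_kermxP (submx_trans vF sub)) mxE.
apply: submx_trans sup; apply/sub_kermxP/matrixP => i j.
by rewrite !ord1 v0 mxE.
Qed.

End frame_annihilator.

Section contact_charts.
Context {R : realType} (M : contact_manifold3 R).

Lemma open_chart_preimage (i : mfd_index M) (V : set M) : open V ->
  open [set x | (atlas i @` chart_dom (atlas i)) x /\ V (chart_inv (atlas i) x)].
Proof.
move=> oV; rewrite openE => x [xI xV].
apply: filterI; first by apply: open_nbhs_nbhs; split => //; exact: chart_img_open.
by apply: (chart_inv_continuous xI); exact: open_nbhs_nbhs.
Qed.

(** The cross product of a local frame is a local defining form. *)
Lemma contact_local_form (p : M) i : chart_dom (atlas i) p ->
  exists (A : set 'rV[R]_3) alpha,
    A (atlas i p) /\ local_defining_form (contact_dist (c := M)) i A alpha.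
Proof.
move=> pi; have [[xiT xiF] _] := contact_distP M.
have [A [F [[oA Ap] FS xiE]]] := xiF p i pi.
pose I := atlas i @` chart_dom (atlas i).
have oAI : open (A `&` I) by apply: openI => //; exact: chart_img_open.
exists (A `&` I), (fun x => cross3 (F x)); split; first by split=> //; exists p.
split=> [//|x []//|k|].
  have eC a b : Ck_on k (A `&` I) (fun x => F x a b).
    by apply: (Ck_on_mx_entry _ _ oAI); apply: Ck_onS (FS k) => x [].
  have := @Ck_on_lincomb R _ _ k 3 (fun j => delta_mx j 0 : 'cV[R]_3)
    (fun j x => cross3 (F x) j 0) _ oAI.
  have cS j : Ck_on k (A `&` I) (fun x => cross3 (F x) j 0).
    have := Ck_onB oAI (Ck_onM oAI (eC 0 (j + 1)) (eC 1 (j + 2)))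
      (Ck_onM oAI (eC 0 (j + 2)) (eC 1 (j + 1))).
    by apply: Ck_on_ext => // x _; rewrite mxE.
  move=> /(_ cS); apply: Ck_on_ext => // x _.
  apply/matrixP => a b; rewrite summxE (bigD1 a) //= big1 => [|j ja].
    by rewrite !mxE eqxx ord1 addr0 mulr1.
  by rewrite !mxE eq_sym (negbTE ja) mulr0.
move=> q qi [Aq _] v vT; have [Ff E] := xiE q qi Aq.
by rewrite (E v vT) /form_eval; exact: sub_cross3.
Qed.

(** Smoothness near [t] and tangency at [t], tested in a single chart. All
    curves considered are extended to the whole real line, so that endpoints need
    no special treatment. *)
Definition legendrian_at (eta : R -> M) (t : R) := exists i A f,
  [/\ open_nbhs t A, smooth_on A f,
      forall s, A s -> chart_dom (atlas i) (eta s) /\ atlas i (eta s) = f s &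
      forall v, tangent_space (eta t) v -> v i = 'D_1 f t ->
        contact_dist (c := M) (eta t) v].

(** The horizontal arc given in a chart is run through by a smooth step
    function, which stops it before [s] and after [u]; horizontality is
    unaffected by a change of speed. *)
Lemma short_legendrian_arcs (p : M) (V : set M) : open V -> V p ->
  exists2 W, nbhs p W & forall q q', W q -> W q' -> forall s u : R, s < u ->
  exists eta : R -> M, [/\ forall t, legendrian_at eta t, forall t, t <= s -> eta t = q,
    forall t, u <= t -> eta t = q' & forall t, V (eta t)].
Proof.
move=> oV Vp; have [i pi] := atlas_cover p.
have [A0 [alpha [A0p [oA0 A0I aS xiE]]]] := contact_local_form pi.
pose c := atlas i.
pose A := A0 `&` [set x | (c @` chart_dom c) x /\ V (chart_inv c x)].
have oA : open A by apply: openI => //; exact: open_chart_preimage.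
have Ap : A (c p) by split=> //; split; [exists p|rewrite chartK].
have aSA : smooth_on A alpha by move=> k; apply: Ck_onS (aS k) => x [].
have wedge : exists u v w, wedge_dform alpha u v w (c p) != 0.
  by have [_ /(_ i A0 alpha)] := contact_distP M; apply.
have [W0 W0p arcs] := horizontal_arcs oA Ap aSA wedge.
exists (chart_dom c `&` c @^-1` W0).
  apply: filterI; first by apply: open_nbhs_nbhs; split=> //; exact: chart_dom_open.
  exact: (chart_continuous pi).
move=> q q' [qi W0q] [q'i W0q'] s u su.
have [g [gS g0 g1 gA]] := arcs _ _ W0q W0q'.
have st2 t : `|step s u t| < 2.
  have /andP[s0 s1] := step_itv t su; rewrite ger0_norm //.
  by apply: le_lt_trans s1 _; rewrite ltr1n.
pose f t := g (step s u t).
have fA t : A (f t) by have [] := gA _ (st2 t).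
have fS : smooth_on setT f.
  move=> k; apply: (Ck_on_comp_real openT (smooth_step su k) _ (gS k)) => t _.
  exact: st2.
exists (fun t => chart_inv c (f t)); split.
- move=> t; exists i, setT, f; split => //; first by split=> //; exact: openT.
    by move=> r _; have [_ [[x xi <-] _]] := fA r; rewrite -/c chartK.
  move=> v vT vi; have [A0f [[x xi xf] _]] := fA t.
  have fE : atlas i (chart_inv c (f t)) = f t by rewrite -xf chartK.
  have fi : chart_dom (atlas i) (chart_inv c (f t)) by rewrite -xf chartK.
  apply/(xiE _ fi _ v vT); rewrite fE // vi.
  have dst : differentiable (step s u : R -> R) t by exact: (smooth_step su 1%N).1.
  have dg : differentiable g (step s u t) by exact: (gS 1%N).1 _ (st2 t).
  have -> : 'D_1 f t = 'D_1 (step s u : R -> R) t *: 'D_1 g (step s u t).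
    rewrite -[f]/(g \o (step s u : R -> R)) deriveE; last exact: differentiable_comp.
    rewrite diff_comp //= -(deriveE _ dst) -[X in 'd g _ X]mulr1.
    rewrite [X in 'd g _ X](_ : _ = 'D_1 (step s u : R -> R) t *: (1 : R)) //.
    by rewrite linearZ /= (deriveE _ dg).
  by rewrite form_evalZ; have [_ ->] := gA _ (st2 t); rewrite mulr0.
- by move=> t ts; rewrite /f step_left // g0 chartK.
- by move=> t ut; rewrite /f step_right // g1 chartK.
- by move=> t; have [_ [_]] := fA t.
Qed.

End contact_charts.

(** * Gluing Legendrian arcs along a continuous path *)

Section gluing.
Context {R : realType} (M : contact_manifold3 R).
Implicit Types (eta gamma : R -> M).

Lemma legendrian_at_ext eta eta' (B : set R) t : open_nbhs t B ->
  (forall s, B s -> eta s = eta' s) -> legendrian_at eta t -> legendrian_at eta' t.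
Proof.
move=> [oB Bt] ee' [i [A [f [[oA At] fS fE xi]]]].
exists i, (A `&` B), f; split.
- by split; [exact: openI|split].
- by move=> k; apply: Ck_onS (fS k) => x [].
- by move=> s [As Bs]; rewrite -ee' //; exact: fE.
- by rewrite -ee'.
Qed.

Lemma legendrian_at_shift eta a t :
  legendrian_at eta (t - a) -> legendrian_at (fun s => eta (s - a)) t.
Proof.
move=> [i [A [f [[oA At] fS fE xi]]]].
have sc : continuous (fun s : R => s - a).
  by move=> s; apply: cvgB; [exact: cvg_id|exact: cvg_cst].
have oB : open ((fun s : R => s - a) @^-1` A) by apply: open_comp => // s _; exact: sc.
exists i, ((fun s => s - a) @^-1` A), (fun s => f (s - a)); split => //.
- move=> k; apply: (@Ck_on_comp_real _ _ _ _ _ _ A) (fS k) => //.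
  by apply: (Ck_onB oB); [exact: Ck_on_id|exact: Ck_on_cst].
- by move=> s /fE.
- move=> v vT vi; apply: xi => //; rewrite vi.
  have df : differentiable f (t - a) by exact: (fS 1%N).1.
  have ds : is_derive t 1 (fun s : R => s - a) 1.
    by apply: is_derive_eq; rewrite subr0.
  have dsd : differentiable (fun s : R => s - a) t.
    by apply/derivable1_diffP; have [] := ds.
  rewrite -[fun s => f (s - a)]/(f \o (fun s : R => s - a)).
  rewrite deriveE; last exact: differentiable_comp.
  rewrite diff_comp //= -(deriveE _ dsd) (@derive_val _ _ _ _ _ _ _ ds).
  by rewrite -(deriveE _ df).
Qed.

Lemma legendrian_at_continuous eta t : legendrian_at eta t -> {for t, continuous eta}.
Proof.
move=> [i [A [f [[oA At] fS fE _]]]].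
have [ti tf] := fE t At.
have nA : \forall s \near t, A s by exact: open_nbhs_nbhs.
have cf : {for t, continuous (chart_inv (atlas i) \o f)}.
  apply: continuous_comp; first exact: (fS 0%N).
  by rewrite -tf; apply: chart_inv_continuous; exists (eta t).
have E : eta t = (chart_inv (atlas i) \o f) t by rewrite /= -tf chartK.
rewrite /prop_for /continuous_at E; apply: cvg_trans cf; apply: near_eq_cvg.
by apply: filterS nA => s /fE[si sf]; rewrite /= -sf chartK.
Qed.

Variables (gamma : R -> M) (G : set (R * M)).
Hypothesis gamma_cont : continuous gamma.
Hypothesis oG : open G.

(** The margin [e] on which the approximation is constant is what makes
    concatenation smooth. *)
Definition approx_on (s u : R) := exists eta, exists2 e : R, 0 < e &
  [/\ forall t, legendrian_at eta t, forall t, t <= s + e -> eta t = gamma s,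
      forall t, u - e <= t -> eta t = gamma u &
      forall t, s <= t <= u -> G (t, eta t)].

Lemma approx_on_trans s u w : s < u -> u < w ->
  approx_on s u -> approx_on u w -> approx_on s w.
Proof.
move=> su uw [eta1 [e1 e10 [L1 s1 u1 G1]]] [eta2 [e2 e20 [L2 s2 u2 G2]]].
(* The two curves agree on the overlap ]u, u + e2[, where both are constant. *)
pose eta t := if t <= u then eta1 t else eta2 t.
have etal t : t < u + e2 -> eta t = eta1 t.
  move=> tu2; rewrite /eta; case: leP => // ut.
  have -> : eta2 t = gamma u by apply: s2; exact: ltW.
  by rewrite u1 //; lra.
have etar t : u < t -> eta t = eta2 t by rewrite /eta ltNge => /negbTE ->.
exists eta, (Num.min (Num.min e1 e2) (Num.min (u - s) ((w - u) / 2))).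
  by rewrite !lt_min e10 e20 subr_gt0 su divr_gt0 // subr_gt0.
set e := Num.min _ _.
have [ee1 ee2 eus ewu] : [/\ e <= e1, e <= e2, e <= u - s & e <= (w - u) / 2].
  by split; rewrite /e !ge_min lexx ?orbT.
split.
- move=> t; have [tu|ut] := ltP t (u + e2).
    apply: (@legendrian_at_ext eta1 _ [set x | x < u + e2]) (L1 t).
      by split => //; exact: open_lt.
    by move=> x xu; rewrite etal.
  apply: (@legendrian_at_ext eta2 _ [set x | u < x]) (L2 t).
    by split; [exact: open_gt|rewrite /=; lra].
  by move=> x xu; rewrite etar.
- by move=> t ts; rewrite /eta ifT; [apply: s1|]; lra.
- by move=> t wt; rewrite etar; [apply: u2|]; lra.
- move=> t /andP[st tw]; have [tu|ut] := leP t u.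
    by rewrite /eta tu; apply: G1; rewrite st.
  by rewrite etar //; apply: G2; rewrite tw ltW.
Qed.

Lemma approx_on_local t : G (t, gamma t) -> exists2 d : R, 0 < d &
  forall s u, s < u -> `|s - t| < d -> `|u - t| < d -> approx_on s u.
Proof.
move=> Gt.
have : nbhs (t, gamma t) G by exact: open_nbhs_nbhs.
move=> [[P V] /= [Pt Vt] PVG].
have [V' [[oV' V't] V'V]] : exists V' : set M, open_nbhs (gamma t) V' /\ V' `<=` V.
  by move: Vt; rewrite nbhsE => -[V' V'o V'V]; exists V'.
have [W Wt arcs] := short_legendrian_arcs oV' V't.
have : nbhs t (P `&` gamma @^-1` W) by apply: filterI => //; exact: gamma_cont.
move=> /nbhs_ballP[d /= d0 dP]; exists d => // s u su sd ud.
have dPW x : `|x - t| < d -> P x /\ W (gamma x).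
  by move=> xd; apply: dP; rewrite -ball_normE /ball_ /= distrC.
have h : s + (u - s) / 3 < u - (u - s) / 3 by lra.
have [eta [L l r V'eta]] := arcs _ _ (dPW _ sd).2 (dPW _ ud).2 _ _ h.
exists eta, ((u - s) / 3); first by rewrite divr_gt0 // subr_gt0.
split=> // x /andP[sx xu]; apply: PVG; split; last exact/V'V/V'eta.
apply: (dPW x _).1; move: sd ud; rewrite !ltr_norml => /andP[? ?] /andP[? ?].
by apply/andP; split; lra.
Qed.

(** Compactness of [a, b] in the form of a supremum argument: the set of t such
    that gamma can be approximated on [a, t] contains its supremum, which is b. *)
Lemma legendrian_approx a b : a < b -> (forall t, a <= t <= b -> G (t, gamma t)) ->
  approx_on a b.
Proof.
move=> ab Gab.
have loc t : a <= t <= b -> exists2 d : R, 0 < d &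
    forall s u, s < u -> `|s - t| < d -> `|u - t| < d -> approx_on s u.
  by move=> /Gab; exact: approx_on_local.
pose S := [set t | a < t <= b /\ approx_on a t].
have aab : a <= a <= b by rewrite lexx ltW.
have [d0 d00 loca] := loc a aab.
pose t0 := Num.min b (a + d0 / 2).
have at0 : a < t0 by rewrite lt_min ab ltrDl divr_gt0.
have t0d : t0 <= a + d0 / 2 by rewrite ge_min lexx orbT.
have St0 : S t0.
  split; first by rewrite at0 ge_min lexx.
  apply: loca => //; first by rewrite subrr normr0.
  by rewrite gtr0_norm ?subr_gt0 //; lra.
have Sb : ubound S b by move=> t [/andP[]].
have S0 : S !=set0 by exists t0.
have supS : has_sup S by split => //; exists b.
pose c := sup S.
have le_c x : S x -> x <= c by move=> Sx; apply: ub_le_sup => //; exists b.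
have t0c : t0 <= c by exact: le_c.
have cb : c <= b by exact: ge_sup.
have acb : a <= c <= b by rewrite cb (le_trans _ t0c) // ltW.
have [d d_gt0 locc] := loc c acb.
have [t St tc] := sup_adherent d_gt0 supS; rewrite -/c in tc.
have tle : t <= c by exact: le_c.
have [/andP[at_ tb] aat] := St.
have td : `|t - c| < d by rewrite ltr_norml; apply/andP; split; lra.
have step u : t < u -> u <= b -> `|u - c| < d -> S u.
  move=> tu ub ud; split; first by rewrite ub (lt_trans at_).
  by apply: (approx_on_trans at_ tu aat); exact: locc.
have [cb'|cb'] := ltP c b.
  pose u := Num.min b (c + d / 2).
  have cu : c < u by rewrite lt_min cb' ltrDl divr_gt0.
  have ud : u <= c + d / 2 by rewrite ge_min lexx orbT.
  have : S u.
    apply: step; [exact: le_lt_trans cu|by rewrite ge_min lexx|].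
    by rewrite gtr0_norm ?subr_gt0 //; lra.
  by move=> /le_c; rewrite leNgt cu.
have {cb cb'}cE : c = b by apply: le_anti; rewrite cb.
have [tb'|tb'] := ltP t b; last by have <- : t = b by apply: le_anti; rewrite tb.
have [] // : S b by apply: step => //; rewrite cE subrr normr0.
Qed.

End gluing.

Section legendrian_of_line.
Context {R : realType} (M : contact_manifold3 R) (N : compact_1manifold R).
Variables (eta : N -> M) (E : R -> M).
Hypothesis etaE : forall t x, param_at t x -> eta x = E t.

(** The coordinate expression in any other chart is obtained by composing with a
    transition map; the family of its derivatives is a tangent vector by the
    chain rule. *)
Lemma legendrian_of_line : (forall t, legendrian_at E t) -> legendrian eta.
Proof.
move=> LE.
suff key t : exists F : mfd_index M -> R -> 'rV[R]_3,
    (forall j, chart_dom (atlas j) (E t) ->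
       exists A, [/\ open_nbhs t A, smooth_on A (F j) &
         forall s, A s -> chart_dom (atlas j) (E s) /\ atlas j (E s) = F j s]) /\
    (forall v, tangent_space (E t) v ->
       (forall j, chart_dom (atlas j) (E t) -> v j = 'D_1 (F j) t) ->
       contact_dist (c := M) (E t) v).
  have loc (x : N) t j (F : mfd_index M -> R -> 'rV[R]_3) : param_at t x ->
       (exists A, [/\ open_nbhs t A, smooth_on A (F j) &
         forall s, A s -> chart_dom (atlas j) (E s) /\ atlas j (E s) = F j s]) ->
       smooth_local_expression eta j t (F j).
    move=> tx [A [oA FS FE]]; exists A; split=> // s y As sy.
    by rewrite (etaE sy); exact: FE.
  split=> [x t i tx xi|x t tx].
    have [F [FP _]] := key t; exists (F i). apply: (loc x t i F tx (FP i _)).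
    by rewrite -(etaE tx).
  have [F [FP Fxi]] := key t; rewrite (etaE tx).
  pose v j := if pselect (chart_dom (atlas j) (E t)) then 'D_1 (F j) t else 0.
  have vE j : chart_dom (atlas j) (E t) -> v j = 'D_1 (F j) t.
    by rewrite /v; case: pselect.
  have vT : tangent_space (E t) v.
    split=> [j nj|j k tj tk]; first by rewrite /v; case: pselect.
    rewrite (vE j tj) (vE k tk).
    have [Aj [[oAj Ajt] FjS FjE]] := FP j tj.
    have [Ak [[oAk Akt] FkS FkE]] := FP k tk.
    have dFj : differentiable (F j) t by exact: (FjS 1%N).1.
    have [_ Fjt] := FjE t Ajt.
    have dT : differentiable (transition (atlas j) (atlas k)) (F j t).
      apply: (atlas_smooth j k 1%N).1; rewrite -Fjt; exists (E t) => //.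
    have -> : 'D_1 (F k) t = 'D_1 (transition (atlas j) (atlas k) \o F j) t.
      apply: near_eq_derive.
      have nA : \forall s \near t, (Aj `&` Ak) s.
        by apply: open_nbhs_nbhs; split; [exact: openI|split].
      apply: filterS nA => s [/FjE[sj Fjs] /FkE[sk Fks]].
      by rewrite /= /transition -Fjs chartK // Fks.
    rewrite deriveE; last exact: differentiable_comp.
    by rewrite diff_comp //= Fjt (deriveE _ dFj).
  exists v; split; last by apply: Fxi.
  split; first by rewrite (etaE tx).
  move=> j; rewrite (etaE tx) => tj; exists (F j).
  by split; [exact: (loc x t j F tx (FP j tj))|rewrite derive1E vE].
have [i [A [f [[oA At] fS fE xi]]]] := LE t.
exists (fun j => transition (atlas i) (atlas j) \o f); split=> [j tj|v vT vE]; last first.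
  apply: xi => //; have [ti tf] := fE t At; rewrite (vE i ti); apply: near_eq_derive.
  have nA : \forall s \near t, A s by exact: open_nbhs_nbhs.
  by apply: filterS nA => s /fE[si sf]; rewrite /= /transition -sf chartK.
pose Aj := A `&` (E @^-1` chart_dom (atlas j)).
have oAj : open Aj.
  rewrite openE => s [As sj]; apply: filterI; first exact: open_nbhs_nbhs.
  apply: (legendrian_at_continuous (LE s)); apply: open_nbhs_nbhs; split => //.
  exact: chart_dom_open.
exists Aj; split; first by split.
  move=> k.
  have oAjk := fS k; have fSk : Ck_on k Aj f by apply: Ck_onS (fS k) => x [].
  have := @Ck_on_comp_lincomb R R _ _ k 3 (fun l => delta_mx 0 l) (fun l s => f s 0 l)
    (transition (atlas i) (atlas j)) Aj _ oAj
    (fun l => Ck_on_mx_entry 0 l oAj fSk) _ (atlas_smooth i j k).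
  have fsum s : \sum_l f s 0 l *: delta_mx 0 l = f s by rewrite -row_sum_delta.
  move=> H; have {}H := H _; apply: (Ck_on_ext oAj) (H _) => [s _|s [As sj]].
    by rewrite /= fsum.
  by have [si sf] := fE s As; rewrite fsum -sf; exists (E s).
move=> s [As sj]; have [si sf] := fE s As; split=> //.
by rewrite /= /transition -sf chartK.
Qed.

End legendrian_of_line.

(** * Periodic extension of a curve on a period *)

Section periodic_extension.
Context {R : realType} (M : contact_manifold3 R).

Definition turns (t : R) : int := Num.floor (t / (2 * pi)).
Definition angle (t : R) : R := t - 2 * pi * (turns t)%:~R.

Lemma twopi_gt0 : 0 < 2 * pi :> R.
Proof. by rewrite mulr_gt0 // pi_gt0. Qed.

Lemma turnsP n (t : R) : 2 * pi * n%:~R <= t < 2 * pi * (n + 1)%:~R -> turns t = n.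
Proof.
move=> /andP[t1 t2]; apply: floor_def.
by rewrite ler_pdivlMr ?twopi_gt0 // ltr_pdivrMr ?twopi_gt0 // mulrC t1 mulrC.
Qed.

Lemma angle_itv (t : R) : 0 <= angle t < 2 * pi.
Proof.
move: twopi_gt0; rewrite /angle /turns; move: (2 * pi) => w w0.
have := floor_itv (t / w); rewrite ler_pdivlMr // ltr_pdivrMr // intrD mulr1z.
by move: (Num.floor _)%:~R => x /andP[h1 h2]; apply/andP; split; lra.
Qed.

Lemma angleP (n : int) (r : R) : 0 <= r < 2 * pi -> angle (r + 2 * pi * n%:~R) = r.
Proof.
move=> /andP[r0 r1]; rewrite /angle (turnsP (n := n)) ?addrK //.
rewrite intrD mulr1z; move: r1; move: (2 * pi) (n%:~R) => w x rw.
by apply/andP; split; lra.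
Qed.

Lemma cos_sin_period (n : int) (t : R) :
  cos (t + 2 * pi * n%:~R) = cos t /\ sin (t + 2 * pi * n%:~R) = sin t.
Proof.
have nat_case (k : nat) (s : R) :
    cos (s + 2 * pi * k%:R) = cos s /\ sin (s + 2 * pi * k%:R) = sin s.
  have -> : 2 * pi * k%:R = (pi *+ 2) *+ k :> R.
    by rewrite mulr_natr mulr_natl.
  by split; [exact: (periodicn (@cosD2pi R) k s)|exact: (periodicn (@sinD2pi R) k s)].
case: n => k; first exact: nat_case.
rewrite NegzE intrN mulrN; have [c s] := nat_case k.+1 (t - 2 * pi * k.+1%:R).
by rewrite subrK in c s; rewrite c s.
Qed.

Lemma cos_sin_angle (t : R) : cos (angle t) = cos t /\ sin (angle t) = sin t.
Proof.
by have [c s] := cos_sin_period (turns t) (angle t); rewrite subrK in c s.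
Qed.

Lemma cos_eq1 (d : R) : 0 <= d < 2 * pi -> cos d = 1 -> d = 0.
Proof.
move=> /andP[d0 d2] cd.
have small x : 0 <= x <= pi -> cos x = 1 -> x = 0.
  move=> x0 cx; apply: cos_inj; rewrite ?in_itv //= ?lexx ?pi_ge0 //.
  by rewrite cx cos0.
have [dpi|dpi] := leP d pi; first by apply: small; rewrite ?d0.
have h : 2 * pi - d = 0.
  apply: small; first by apply/andP; split; lra.
  have [c _] := cos_sin_period 1 (d - 2 * pi).
  by rewrite mulr1z mulr1 subrK cd in c; rewrite -cosN opprB.
by have := d2; lra.
Qed.

Lemma cos_sin_inj (t t' : R) : cos t = cos t' -> sin t = sin t' -> angle t = angle t'.
Proof.
move=> cc ss; have [c s] := cos_sin_angle t; have [c' s'] := cos_sin_angle t'.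
have := angle_itv t; have := angle_itv t'.
move: c s c' s'; move: (angle t) (angle t') => r r' c s c' s' r'i ri.
have crr : cos (r - r') = 1 by rewrite cosB c s c' s' cc ss -!expr2 cos2Dsin2.
have [le|lt] := leP r' r.
  apply/eqP; rewrite -subr_eq0; apply/eqP; apply: cos_eq1 => //.
  by move: ri r'i => /andP[? ?] /andP[? ?]; apply/andP; split; lra.
apply/esym/eqP; rewrite -subr_eq0; apply/eqP; apply: cos_eq1.
  by move: ri r'i => /andP[? ?] /andP[? ?]; apply/andP; split; lra.
by rewrite -cosN opprB.
Qed.

Lemma circle_angle (c s : R) : c ^+ 2 + s ^+ 2 = 1 -> exists t, c = cos t /\ s = sin t.
Proof.
move=> cs; have c1 : -1 <= c <= 1.
  by have := sqr_ge0 s => s0; apply/andP; split; nra.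
have sE : Num.sqrt (1 - c ^+ 2) = `|s| by rewrite -cs addrC addKr sqrtr_sqr.
have ck : cos (acos c) = c by apply: acosK; rewrite in_itv.
have [s0|s0] := leP 0 s.
  by exists (acos c); rewrite ck sin_acos // sE ger0_norm.
by exists (- acos c); rewrite cosN sinN ck sin_acos // sE ltr0_norm // opprK.
Qed.

(** Away from multiples of 2 pi the periodic extension is locally a translate of
    [E0]; near them it is constant, because [E0] is constant near both ends of
    the period. *)
Lemma legendrian_at_periodic (E0 : R -> M) (p : M) (e : R) : 0 < e ->
  (forall t, legendrian_at E0 t) -> (forall t, t <= e -> E0 t = p) ->
  (forall t, 2 * pi - e <= t -> E0 t = p) -> forall t, legendrian_at (E0 \o angle) t.
Proof.
move=> e0 L l r t; have /andP[a0 a1] := angle_itv t.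
have tE : t = angle t + 2 * pi * (turns t)%:~R by rewrite /angle subrK.
set n := turns t in tE; have tp := twopi_gt0.
have intr1 (m : int) : (m + 1)%:~R = m%:~R + 1 :> R by rewrite intrD.
have [at0|at0] := ltP 0 (angle t).
  apply: (@legendrian_at_ext _ _ (fun s => E0 (s - 2 * pi * n%:~R)) _
     [set s | 2 * pi * n%:~R < s < 2 * pi * (n + 1)%:~R]); last first.
  - by apply: legendrian_at_shift; exact: L.
  - move=> s /andP[s1 s2]; rewrite /= /angle (turnsP (n := n)) //.
    by rewrite (ltW s1).
  - split; last by rewrite /= intr1; apply/andP; split; lra.
    rewrite (_ : mkset _ =
        [set s | 2 * pi * n%:~R < s] `&` [set s | s < 2 * pi * (n + 1)%:~R]).
      by apply: openI; [exact: open_gt|exact: open_lt].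
    by apply/seteqP; split=> s /=; [move/andP|move=> ?; apply/andP].
have {}at0 : angle t = 0 by apply: le_anti; rewrite at0 a0.
rewrite at0 add0r in tE.
pose d := Num.min (Num.min e 1) (2 * pi).
have [de d1 dpi] : [/\ d <= e, d <= 1 & d <= 2 * pi].
  by split; rewrite /d !ge_min lexx ?orbT.
have d0 : 0 < d by rewrite /d !lt_min e0 ltr01 tp.
(* Translating by t + 1 puts a neighbourhood of t to the left of the period,
   where E0 is constant. *)
apply: (@legendrian_at_ext _ _ (fun s => E0 (s - (t + 1))) _
  [set s | t - d < s < t + d]); last first.
- by apply: legendrian_at_shift; exact: L.
- move=> s /andP[s1 s2]; rewrite /= l; last lra.
  have [ts|st] := leP t s.
    have -> : angle s = s - t.
      rewrite -[in LHS](subrK t s) tE angleP //.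
      by rewrite -tE; apply/andP; split; lra.
    by rewrite l //; lra.
  have -> : angle s = s - t + 2 * pi.
    have -> : s = (s - t + 2 * pi) + 2 * pi * (n - 1)%:~R.
      by rewrite intrB mulrBr {1}tE; ring.
    rewrite angleP; last by apply/andP; split; lra.
    by rewrite intrB mulrBr -tE; ring.
  by rewrite r //; lra.
- split; last by rewrite /=; apply/andP; split; lra.
  rewrite (_ : mkset _ = [set s | t - d < s] `&` [set s | s < t + d]).
    by apply: openI; [exact: open_gt|exact: open_lt].
  by apply/seteqP; split=> s /=; [move/andP|move=> ?; apply/andP].
Qed.

End periodic_extension.

(** * Legendrian approximation on the interval and on the circle *)

Section whitney.
Context {R : realType} (M : contact_manifold3 R).

Lemma whitney_base_nbhs (N T : topologicalType) (f : whitneyC0 N T)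
    (U : set (whitneyC0 N T)) :
  open_nbhs f U -> exists2 A : set (N * T), open A & whitney_base A f /\
    whitney_base A `<=` U.
Proof.
move=> [[D Do UE] Uf]; rewrite -UE in Uf; have [A DA Af] := Uf.
by exists A; [exact: Do|split=> // g Ag; rewrite -UE; exists A].
Qed.

(** A neighbourhood of the graph of [f] pulls back along the parametrization [P]
    to a neighbourhood of the graph of [f \o P]. *)
Lemma line_approx (N : topologicalType) (P : R -> N) (f : N -> M) (A : set (N * M)) a b :
  continuous P -> continuous f -> open A -> (forall x, A (x, f x)) -> a < b ->
  exists E, exists2 e : R, 0 < e &
  [/\ forall t, legendrian_at E t, forall t, t <= a + e -> E t = f (P a),
      forall t, b - e <= t -> E t = f (P b) &
      forall t, a <= t <= b -> A (P t, E t)].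
Proof.
move=> Pc fc oA Af ab.
pose G := [set p : R * M | A (P p.1, p.2)].
have oG : open G.
  apply: (@open_comp _ _ (fun p : R * M => (P p.1, p.2)) A) => // p _.
  apply: cvg_pair; last exact: cvg_snd.
  by apply: (continuous_comp _ (Pc _)); exact: cvg_fst.
have gc : continuous (f \o P) by move=> t; apply: continuous_comp; [exact: Pc|exact: fc].
exact: (legendrian_approx gc oG ab (fun t _ => Af (P t))).
Qed.

Lemma set_type_surj (T : Type) (B : set T) (x : T) :
  B x -> exists y : set_type B, \val y = x.
Proof. by move=> Bx; exists (exist (fun z => z \in B) x (mem_set Bx)). Qed.

Lemma subtype_continuous (T S : topologicalType) (B : set T) (g : S -> set_type B) :
  continuous (fun s => \val (g s)) -> continuous g.
Proof.
move=> /continuousP vg; apply/continuousP => _ [C oC <-].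
exact: vg.
Qed.

Lemma legendrian_approx_interval a b (ab : a < b)
    (upsilon : whitneyC0 (CompactInterval ab) M)
    (A : set (CompactInterval ab * M)) : open A -> whitney_base A upsilon ->
  exists2 eta : whitneyC0 (CompactInterval ab) M, legendrian eta & whitney_base A eta.
Proof.
move=> oA Au.
have /choice[P PE] : forall t : R, exists x : CompactInterval ab,
    \val x = Num.max a (Num.min b t).
  move=> t; have h : [set s : R | a <= s <= b] (Num.max a (Num.min b t)).
    by rewrite /= le_max lexx ge_max ge_min lexx (ltW ab).
  exact: set_type_surj h.
have Pc : continuous P.
  apply: subtype_continuous => t; rewrite (funext PE).
  apply: (@continuous_max _ _ (cst a) (fun s : R => Num.min b s)).
    exact: cvg_cst.
  by apply: (@continuous_min _ _ (cst b) id); [exact: cvg_cst|exact: cvg_id].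
have PK (x : CompactInterval ab) : P (\val x) = x.
  apply: val_inj; rewrite PE; have /set_mem /andP[x1 x2] := svalP x.
  by rewrite min_r // max_r.
have [E [e _ [L _ _ EA]]] := line_approx Pc (@cts_fun _ _ upsilon) oA Au ab.
pose eta (x : CompactInterval ab) : M := E (\val x).
have ec : continuous eta.
  move=> x; apply: (@continuous_comp _ _ _ (fun x : CompactInterval ab => \val x) E).
    exact: initial_continuous.
  exact: legendrian_at_continuous.
pose etaC : continuousType (CompactInterval ab) M :=
  HB.pack eta (isContinuous.Build _ _ eta ec).
exists (etaC : whitneyC0 (CompactInterval ab) M).
  by apply: (@legendrian_of_line _ _ _ _ E) => // t x tx; rewrite /= /eta tx.
move=> x; have := EA (\val x); rewrite PK; apply.
by have /set_mem := svalP x.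
Qed.

(** The curve descends from the line to the circle because it is periodic;
    continuity of the quotient map follows since the parametrization maps compact
    subsets of a period to closed subsets of the circle. *)
Lemma legendrian_approx_circle (upsilon : whitneyC0 (Circle R) M)
    (A : set (Circle R * M)) : open A -> whitney_base A upsilon ->
  exists2 eta : whitneyC0 (Circle R) M, legendrian eta & whitney_base A eta.
Proof.
move=> oA Au.
have /choice[P PE] : forall t : R, exists x : Circle R, \val x = (cos t, sin t).
  move=> t; have h : [set z : R * R | z.1 ^+ 2 + z.2 ^+ 2 = 1] (cos t, sin t).
    exact: cos2Dsin2.
  exact: set_type_surj h.
have csc : continuous (fun t : R => (cos t, sin t)).
  move=> t; exact: (cvg_pair (@continuous_cos R t) (@continuous_sin R t)).
have Pc : continuous P.
  by apply: subtype_continuous => t; rewrite (funext PE); exact: csc.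
have Peq (x : Circle R) t : param_at t x -> P t = x.
  by move=> tx; apply: val_inj; rewrite PE tx.
have P2 : P (2 * pi) = P 0.
  have [c s] := cos_sin_period 1 (0 : R); rewrite mulr1z mulr1 add0r in c s.
  by apply: val_inj; rewrite !PE c s.
have [E0 [e e0 [L l r EA]]] := line_approx Pc (@cts_fun _ _ upsilon) oA Au (@twopi_gt0 R).
rewrite P2 in r; rewrite add0r in l.
have LE := legendrian_at_periodic e0 L l r.
pose E := E0 \o @angle R.
have /choice[th thP] : forall x : Circle R, exists t : R, \val x = (cos t, sin t).
  move=> x; have /set_mem /= := svalP x; case: (\val x) => c s /=.
  by move=> /circle_angle[t [-> ->]]; exists t.
pose eta (x : Circle R) : M := E (th x).
have etaE t x : param_at t x -> eta x = E t.
  move=> tx; have [cc ss] := etrans (esym tx) (thP x).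
  by rewrite /eta /E /= (cos_sin_inj cc ss).
have Ec : continuous E by move=> t; exact: legendrian_at_continuous (LE t).
have ang (x : Circle R) : exists2 t, 0 <= t <= 2 * pi & param_at t x.
  exists (angle (th x)); first by have /andP[-> /ltW ->] := angle_itv (th x).
  by have [c s] := cos_sin_angle (th x); rewrite /= c s; exact: thP.
have ec : continuous eta.
  apply/continuous_closedP => C cC.
  have cK : compact (`[0, 2 * pi] `&` E @^-1` C).
    apply: (subclosed_compact _ (@segment_compact R 0 (2 * pi))); last by move=> t [].
    apply: closedI; first exact: interval_closed.
    by apply: preimage_closed => // t _; exact: Ec.
  have cI := continuous_compact (continuous_subspaceT csc) cK.
  have clI := compact_closed (@norm_hausdorff _ _) cI.
  have -> : eta @^-1` C = (fun x : Circle R => \val x) @^-1`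
      ((fun t : R => (cos t, sin t)) @` (`[0, 2 * pi] `&` E @^-1` C)).
    apply/seteqP; split=> x /=.
      have [t t01 tx] := ang x; rewrite (etaE t x tx) => CE.
      by exists t => //; split.
    by move=> [t [_ Ct] tx]; rewrite (etaE t x).
  by apply: preimage_closed => // x _; exact: initial_continuous.
pose etaC : continuousType (Circle R) M := HB.pack eta (isContinuous.Build _ _ eta ec).
exists (etaC : whitneyC0 (Circle R) M).
  exact: (@legendrian_of_line _ _ _ _ E).
move=> x; have [t t01 tx] := ang x.
rewrite /= (etaE t x tx) /E /=.
have <- : P (angle t) = x.
  by apply: Peq; have [c s] := cos_sin_angle t; rewrite /= c s.
by apply: EA; have /andP[-> /ltW ->] := angle_itv t.
Qed.

End whitney.

Theorem theorem1p1 (R : realType) (M : contact_manifold3 R)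
    (N : compact_1manifold R) (upsilon : whitneyC0 N M)
    (U : set (whitneyC0 N M)) (hU : open_nbhs upsilon U) :
  exists eta : whitneyC0 N M, legendrian eta /\ U eta.
Proof.
have [A oA [Au AU]] := whitney_base_nbhs hU.
case: N upsilon U hU A oA Au AU => [a b ab|] upsilon U _ A oA Au AU.
  by have [eta Le /AU] := legendrian_approx_interval oA Au; exists eta.
by have [eta Le /AU] := legendrian_approx_circle oA Au; exists eta.
Qed.
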